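(* Fix $\delta\in(0,1)$ and let $\mathcal S$ be a class of measurable sets containing $\emptyset$ and $\mathcal X$ with $\mathrm{VC}(\mathcal S)<\infty$. For $\alpha\in[0,1]$ define $$\hat L(\alpha)=\Bigl[\inf_{S\in\mathcal S:\,h_-(P_n(S))\leq\alpha}h_-(Q_n(S^{c}))\Bigr]\vee 0,\qquad \hat U(\alpha)=\Bigl[\inf_{S\in\mathcal S:\,h_+(P_n(S))\leq\alpha}h_+(Q_n(S^{c}))\Bigr]\wedge(1-\alpha),$$ and let $\hat L_{\mathrm{GCM}}$ be the greatest convex minorant of $\hat L$ on $[0,1]$. Then, for arbitrary distribution pairs $(P,Q)$, with probability at least $1-\delta$, $$T(P,Q)(\alpha)\leq\hat U(\alpha)\quad\text{for all }\alpha\in[0,1].$$ Moreover, if in addition $(P,Q)\in\mathcal M_{\mathcal S}$, then with probability at least $1-\delta$, $$\hat L_{\mathrm{GCM}}(\alpha)\leq T(P,Q)(\alpha)\leq\hat U(\alpha)\quad\text{for all }\alpha\in[0,1].$$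
   Context: For probability distributions $P,Q$ on a measurable space $(\mathcal X,\mathcal A)$, the trade-off function is $T(P,Q)(\alpha)=\inf\{E_Q[1-\varphi]:\ \varphi:\mathcal X\to[0,1]\text{ measurable},\ E_P[\varphi]\leq\alpha\}$, $\alpha\in[0,1]$. Data: $X_{1:n}\sim P^n$ and $Y_{1:n}\sim Q^n$ are independent samples with empirical distributions $P_n=\frac1n\sum_i\delta_{X_i}$, $Q_n=\frac1n\sum_i\delta_{Y_i}$; probabilities are under $P^n\times Q^n$. VC dimension: a finite $A$ is shattered by $\mathcal S$ if $\mathrm{card}\{A\cap S:S\in\mathcal S\}=2^{\mathrm{card}(A)}$; $\mathrm{VC}(\mathcal S)$ is the largest cardinality of a shattered set. Confidence maps: $\tau_{n,\delta}=\frac{4\{\mathrm{VC}(\mathcal S)\log(2n)+\log(32/\delta)\}}{n}$, with $n$ always assumed large enough that $\tau_{n,\delta}\leq\frac12$; $V(t)=\min\{t,(1-t)_+\}$; $h_+(t)=\min\{t+\sqrt{\tau_{n,\delta}V(t)}+\tau_{n,\delta},1\}$; $h_-(t)=t-\sqrt{\tau_{n,\delta}V(t)}-\tau_{n,\delta}$. The infimum over an empty set is $+\infty$. Attainability: a pair $(P,Q)$ is $\mathcal S$-attainable if, with $\mu=(P+Q)/2$, $p=dP/d\mu$, $q=dQ/d\mu$, for every $\lambda\in[0,\infty]$ there is $S\in\mathcal S$ with $\mathbf 1_S=\mathbf 1_{\{q>\lambda p\}}$ $\mu$-a.e. (for $\lambda=\infty$, $\{q>\lambda p\}$ means $\{p=0\}$).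 $\mathcal M_{\mathcal S}$ is the collection of all $\mathcal S$-attainable pairs.
   Formalization: The class S is additionally assumed P- and Q-measurable: for every m and 0/1 pattern, the set of m-point samples on which some S in the class cuts out that pattern is measurable for the completion of P^m (resp. Q^m). Without this the claim fails for some uncountable classes. *)

(* Defs.v *)
From HB Require Import structures.
From mathcomp Require Import all_boot all_order all_algebra.
From mathcomp Require Import all_classical all_reals all_analysis.

Set Implicit Arguments.
Unset Strict Implicit.
Unset Printing Implicit Defensive.
Import Order.TTheory GRing.Theory Num.Theory.
Import numFieldNormedType.Exports.

Local Open Scope card_scope.
Local Open Scope classical_set_scope.
Local Open Scope ring_scope.

Section product_power.
Context d (X : measurableType d) (R : realType).

Definition tcons n (u : X * n.-tuple X) : n.+1.-tuple X := [tuple of u.1 :: u.2].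

Lemma measurable_tcons n : measurable_fun [set: X * n.-tuple X] (@tcons n).
Proof. exact: measurable_cons. Qed.

HB.instance Definition _ n :=
  isMeasurableFun.Build _ _ _ _ (@tcons n) (@measurable_tcons n).

(* The n-fold product measure on [n.-tuple X], by iterating the binary product;
   see [power_measure_box]. *)
Fixpoint power_measure (P : probability X R) n : probability (n.-tuple X) R :=
  if n is m.+1 then distribution (P \x power_measure P m)%E (@tcons m)
  else \d_[tuple].

Lemma power_measure_box (P : probability X R) n (A : 'I_n -> set X) :
  (forall i, measurable (A i)) ->
  power_measure P n [set x | forall i, A i (tnth x i)] =
  (\prod_(i < n) P (A i))%E.
Proof.
elim: n A => [|n IHn] A mA /=.
  by rewrite big_ord0 diracE mem_set// => -[].
have mB : measurable [set x : n.-tuple X | forall i, A (lift ord0 i) (tnth x i)].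
  rewrite (_ : mkset _ = \bigcap_(i in [set: 'I_n])
      ((fun x => tnth x i) @^-1` A (lift ord0 i))); last first.
    by apply/seteqP; split => [x Ax i _|x Ax i]; [exact: Ax|exact: (Ax i)].
  apply: fin_bigcap_measurable => // i _; rewrite -[X in measurable X]setTI.
  exact: measurable_tnth.
rewrite big_ord_recl -IHn// -product_measure1E//.
rewrite /distribution /pushforward; congr (_ _).
apply/seteqP; split => -[x y] /=.
  move=> Axy; split=> [|i] /=; first by have := Axy ord0; rewrite /tcons tnth0.
  by have := Axy (lift ord0 i); rewrite /tcons tnthS.
move=> [Ax Ay] i; rewrite /tcons /=.
by case: (unliftP ord0 i) => [j ->|->]; rewrite ?tnthS ?tnth0//; exact: Ay.
Qed.

End product_power.

(* Inner probability, so that [E] itself need not be measurable. *)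
Definition with_probability_at_least d (T : measurableType d) (R : realType)
    (mu : set T -> \bar R) (c : R) (E : set T) : Prop :=
  exists A, [/\ measurable A, A `<=` E & (c%:E <= mu A)%E].

Section tradeoff.
Context d (X : measurableType d) (R : realType).

Definition tradeoff (P Q : probability X R) (a : R) : \bar R :=
  ereal_inf [set 'E_Q[(fun x => 1 - phi x)%R]%E | phi in
    [set phi : X -> R | [/\ measurable_fun [set: X] phi,
                            forall x, 0 <= phi x <= 1 &
                            ('E_P[phi] <= a%:E)%E]]].

End tradeoff.

Section VC_dimension.
Context (T : Type).
Implicit Types (SS : set (set T)) (A : set T).

Definition shattered_of_card SS A m :=
  A #= `I_m /\ [set A `&` S | S in SS] #= `I_(2 ^ m).

Definition VC (R : realType) SS : \bar R :=
  ereal_sup [set m%:R%:E | m in [set m | exists A, shattered_of_card SS A m]].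

End VC_dimension.

(* Without a measurability assumption on the class [SS], uniform laws over [SS]
   can fail, even when VC(SS) = 1: under CH, take the initial segments of a
   well-order of type omega_1 of [0,1], which are countable, and P = Q =
   Lebesgue. We use the assumption that [SS] is a P-measurable class (van der
   Vaart & Wellner, Weak Convergence and Empirical Processes, Def. 2.3.3): for
   all m and real weights e,
     x |-> sup_(S in SS) `| \sum_i e_i 1_S(x_i) |
   is measurable for the completion of P^m. For a class of sets containing set0
   this means that the set of samples on which a given 0/1 pattern b is cut out
   by a member of [SS] is measurable for that completion. *)
Definition measurable_class d (X : measurableType d) (R : realType)
    (P : probability X R) (SS : set (set X)) : Prop :=
  forall m (b : 'I_m -> bool), exists2 A : set (m.-tuple X), measurable A &
    (power_measure P m).-negligible
      (A `+` [set x | exists2 S, SS S & forall i, S (tnth x i) <-> b i]).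

Section attainability.
Context d (X : measurableType d) (R : realType) (P Q : probability X R).

Definition mixture : set X -> \bar R :=
  mscale (2^-1 : R)%:nng (measure_add P Q).

HB.instance Definition _ := Measure.on mixture.

Lemma mixture_setT : mixture [set: X] = 1%E.
Proof.
have -> : mixture [set: X] = ((2^-1 : R)%:E * (P [set: X] + Q [set: X]))%E.
  by rewrite -measure_addE.
rewrite !probability_setT -EFinD -EFinM.
by rewrite -(natrD R 1 1) mulVf// pnatr_eq0.
Qed.

HB.instance Definition _ := Measure_isProbability.Build _ _ _ mixture mixture_setT.

Definition density (nu : probability X R) : X -> \bar R :=
  Radon_Nikodym (charge_of_finite_measure nu) mixture.

(* The set {q > lambda p}, for lambda in [0, +oo]. *)
Definition LR_region (lambda : \bar R) : set X :=
  if lambda is l%:E then [set x | (l%:E * density P x < density Q x)%E]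
  else [set x | density P x = 0%E].

Definition attainable (SS : set (set X)) : Prop :=
  forall lambda : \bar R, (0 <= lambda)%E -> exists2 S, SS S &
    {ae mixture, forall x, \1_S x = \1_(LR_region lambda) x :> R}.

End attainability.

Section confidence_band.
Context d (X : measurableType d) (R : realType).
Variables (SS : set (set X)) (n : nat) (delta : R).

Definition tau : R :=
  4 * (fine (VC R SS) * ln (2 * n%:R) + ln (32 / delta)) / n%:R.

Definition Vfun (t : R) : R := Num.min t (Num.max (1 - t) 0).

Definition hplus (t : R) : R :=
  Num.min (t + Num.sqrt (tau * Vfun t) + tau) 1.

Definition hminus (t : R) : R := t - Num.sqrt (tau * Vfun t) - tau.

Definition empirical (x : n.-tuple X) (S : set X) : R :=
  n%:R^-1 * \sum_(i < n) \1_S (tnth x i).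

Definition Lhat (x y : n.-tuple X) (a : R) : \bar R :=
  maxe (ereal_inf [set (hminus (empirical y (~` S)))%:E | S in
                    [set S | SS S /\ hminus (empirical x S) <= a]])
       0%E.

Definition Uhat (x y : n.-tuple X) (a : R) : \bar R :=
  mine (ereal_inf [set (hplus (empirical y (~` S)))%:E | S in
                    [set S | SS S /\ hplus (empirical x S) <= a]])
       (1 - a)%:E.

End confidence_band.

(* Greatest convex minorant of [f] on [0, 1]. *)
Definition gcm (R : realType) (f : R -> \bar R) (a : R) : \bar R :=
  ereal_sup [set (g a)%:E | g in
    [set g : R -> R | convex_function (`[0, 1] : set R^o) (g : R^o -> R^o) /\
                      forall t, 0 <= t <= 1 -> ((g t)%:E <= f t)%E]].

(* Main.v *)
From HB Require Import structures.
Require Import Defs.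
From mathcomp Require Import all_boot all_order all_algebra.
From mathcomp Require Import all_classical all_reals all_analysis.
From mathcomp Require Import measurable_realfun interval_inference.
From mathcomp Require Import ring lra zify.

(** Everything follows from one uniform statement about a single sample: with
probability at least 1 - delta / 2, for every S in the class, both the pair
(P S, P_n S) and the pair (P (~S), P_n (~S)) lie in the confidence band, that
is [hminus (P_n S) <= P S <= hplus (P_n S)] ([sample_band]). It is applied to
the first sample with P and to the second one with Q.

The band. A violation of the band by S makes [~` S] or S deviate from its
expectation by more than sqrt (tau P_n) + tau ([deviates]). Draw a ghost
sample of the same size. A binomial variable is within 2 of the good side of
its mean with probability at least 1/3, so with that probability the ghost
sample witnesses the deviation: the numbers a and b of points of S in the two
samples satisfy (a - b)^2 > t (a + b), where t = n tau / 2 ([discrepant]). The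
joint law of the two samples is invariant under exchanging the i-th points of
the two, for any set of indices i. Such random exchanges fix a + b and turn
a - b into a Rademacher sum of variance at most a + b, so that each trace of S
on the 2n points is discrepant with probability at most 2 exp (- t / 2) =
2 exp (- n tau / 4). Summing over S and its complement and over the traces,
of which there are at most 5/4 (2n)^VC by the Sauer-Shelah lemma, gives
3 * 4 * 5/4 * (2n)^VC * exp (- n tau / 4) <= 15/32 delta < delta / 2.

The factor 1/3 comes from the log-concavity of the binomial distribution
function F: by Jensen's inequality ln F (E X) >= E (ln F (X)) >= -1, since
F (X) is stochastically larger than a uniform variable
([binomial_cdf_mean]).

The set of samples on which the band fails need not be measurable. The set of
double samples carrying a discrepant trace is measurable up to a null set, for
a measurable class; the bad samples are contained in the measurable set where
a cover of that set has sections of measure at least 1/3, and Markov's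
inequality bounds the latter.

The bounds. If [hplus (P_n S) <= a] then the indicator of S is a test of level
a, so T(a) <= Q (~` S) <= [hplus (Q_n (~` S))]. For the lower bound, every
convex g below Lhat satisfies g (P S) <= Q (~` S) for all S in the class. Let
s be the slope of a supporting line of g at a. If s <= 0, the likelihood ratio
region for lambda = - s minimizes E_Q [1 - phi] + lambda E_P [phi] by the
Neyman-Pearson lemma, and by attainability it agrees with a member of the
class up to a null set; this gives g a <= E_Q [1 - phi] for every test phi of
level a. If s > 0 then g a <= g 1 <= Q set0 = 0. The end points a = 1 and a = 0
use the whole space and the region for lambda = +oo. *)

Set Implicit Arguments.
Unset Strict Implicit.
Unset Printing Implicit Defensive.
Import Order.TTheory GRing.Theory Num.Theory.
Import numFieldNormedType.Exports.
Local Open Scope ring_scope.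

(** * Rademacher sums and random exchanges *)

Section hoeffding.
Context (R : realType).

Lemma le_of_derive_ge0 (f df : R -> R) (x : R) :
  (forall y, is_derive y (1:R) f (df y)) ->
  (forall y, 0 <= y -> 0 <= df y) -> 0 <= x -> f 0 <= f x.
Proof.
move=> fdf df0 x0.
apply: (@ger0_derive1_ndecr _ f 0 x) => //.
- move=> y; rewrite in_itv/= => /andP[y0 _].
  by rewrite derive1E; have [_ ->] := fdf y; apply/df0/ltW.
- by apply: derivable_within_continuous => y _; have [] := fdf y.
Qed.

Lemma is_deriveN_expR (x : R) : is_derive x (1:R) (fun y => expR (- y))
  (- expR (- x)).
Proof.
have h : is_derive x (1:R) (fun y : R => - y) (-1).
  by apply: is_derive_eq.
have := @is_derive1_comp _ expR (fun y : R => - y) x (expR (- x)) (-1) _ h.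
by rewrite mulrN1; apply.
Qed.

Lemma sinh_le_xcosh (x : R) : 0 <= x ->
  expR x - expR (- x) <= x * (expR x + expR (- x)).
Proof.
move=> x0; rewrite -subr_ge0.
pose f (x : R) := x * (expR x + expR (- x)) - (expR x - expR (- x)).
have D (y : R) : is_derive y (1:R) f (y * (expR y - expR (- y))).
  have dN := is_deriveN_expR y.
  apply: is_derive_eq; rewrite /GRing.scale/=; ring.
have := le_of_derive_ge0 D _ x0; rewrite {1}/f.
rewrite mul0r oppr0 subrr subr0; apply=> y y0.
by rewrite mulr_ge0// subr_ge0 ler_expR; lra.
Qed.

(** The derivative of cosh x * exp (- x^2 / 2) has the sign of
sinh x - x cosh x, which is nonpositive for x >= 0. *)
Lemma cosh_le_expR_sqr (x : R) : expR x + expR (- x) <= 2 * expR (x ^+ 2 / 2).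
Proof.
wlog x0 : x / 0 <= x.
  move=> h; have [/h//|x0] := lerP 0 x.
  have := h (- x); rewrite sqrrN opprK addrC; apply; lra.
pose f (y : R) := - ((expR y + expR (- y)) * expR (- (y ^+ 2 / 2))).
have D (y : R) : is_derive y (1:R) f
    (expR (- (y ^+ 2 / 2)) * (y * (expR y + expR (- y))
      - (expR y - expR (- y)))).
  have dN := is_deriveN_expR y.
  have h : is_derive y (1:R) (fun y : R => - (y ^+ 2 / 2)) (- y).
    by apply: is_derive_eq; rewrite /GRing.scale/=; field.
  have dG : is_derive y (1:R) (fun y : R => expR (- (y ^+ 2 / 2)))
    (- (y * expR (- (y ^+ 2 / 2)))).
    have := @is_derive1_comp _ expR _ y _ (- y) (is_derive_expR _) h.
    by move=> /is_derive_eq; apply; rewrite mulrN mulrC.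
  apply: is_derive_eq; rewrite /GRing.scale/=; ring.
have := le_of_derive_ge0 D _ x0; rewrite /f expr0n/= mul0r !oppr0 expR0 mulr1.
rewrite lerN2 (expRN (x ^+ 2 / 2)) ler_pdivrMr ?expR_gt0//; apply=> y y0.
by rewrite mulr_ge0 ?expR_ge0// subr_ge0 sinh_le_xcosh.
Qed.

Lemma rademacher_mgf n (d : 'I_n -> R) :
  \sum_(s : {ffun 'I_n -> bool}) expR (\sum_i (-1) ^+ s i * d i) <=
  2 ^+ n * expR ((\sum_i d i ^+ 2) / 2).
Proof.
have -> : \sum_(s : {ffun 'I_n -> bool}) expR (\sum_i (-1) ^+ s i * d i) =
    \prod_(i < n) (expR (d i) + expR (- d i)).
  under eq_bigr do rewrite expR_sum.
  rewrite -(bigA_distr_bigA (fun i (b : bool) => expR ((-1) ^+ b * d i))).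
  by apply: eq_bigr => i _; rewrite big_bool addrC expr0 expr1 mul1r mulN1r.
rewrite mulr_suml expR_sum -[X in 2 ^+ X]card_ord -prodr_const -big_split/=.
apply: ler_prod => i _.
by rewrite cosh_le_expR_sqr addr_ge0 ?expR_ge0.
Qed.

(** Chernoff's method. The variance only enters through an upper bound K, so
that K may be chosen independent of the signs of the coefficients. *)
Lemma rademacher_tail n (d : 'I_n -> R) (K s : R) : 0 < K -> 0 <= s ->
  \sum_i d i ^+ 2 <= K ->
  #|[set e : {ffun 'I_n -> bool} | s <= \sum_i (-1) ^+ e i * d i]|%:R <=
  2 ^+ n * expR (- (s ^+ 2 / (2 * K))).
Proof.
move=> K0 s0 dK.
(* The exponent l s - l^2 K / 2 is maximal at l = s / K. *)
pose l := s / K.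
have l0 : 0 <= l by rewrite divr_ge0// ltW.
have := rademacher_mgf (fun i => l * d i).
set A := [set _ | _] => mgf.
have H : #|A|%:R * expR (l * s) <= 2 ^+ n * expR (l ^+ 2 * K / 2).
  apply: (@le_trans _ _ (2 ^+ n * expR ((\sum_(i < n) (l * d i) ^+ 2) / 2)));
    last first.
    rewrite ler_pM2l ?exprn_gt0// ler_expR ler_pM2r ?invr_gt0//.
    under eq_bigr do rewrite exprMn.
    by rewrite -mulr_sumr ler_wpM2l// sqr_ge0.
  apply: le_trans mgf.
  rewrite (bigID (mem A))/= -[leLHS]addr0.
  apply: lerD; last by apply: sumr_ge0 => i _; rewrite expR_ge0.
  rewrite mulr_natl -sumr_const; apply: ler_sum => e.
  rewrite inE => se; rewrite ler_expR.
  under [leRHS]eq_bigr do rewrite mulrCA.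
  by rewrite -mulr_sumr ler_wpM2l.
rewrite -(ler_pM2r (expR_gt0 (l * s))) (le_trans H)// -[leRHS]mulrA -expRD.
rewrite ler_pM2l ?exprn_gt0// ler_expR le_eqVlt; apply/orP; left; apply/eqP.
rewrite /l; field; exact: lt0r_neq0.
Qed.

(** The squared form treats both signs at once and is free of square roots. *)
Lemma rademacher_sqr_tail n (d : 'I_n -> R) (K t : R) : 0 < K -> 0 <= t ->
  \sum_i d i ^+ 2 <= K ->
  #|[set e : {ffun 'I_n -> bool} | t * K <=
    (\sum_i (-1) ^+ e i * d i) ^+ 2]|%:R <=
  2 * (2 ^+ n * expR (- (t / 2))).
Proof.
move=> K0 t0 dK; pose s := Num.sqrt (t * K).
have s0 : 0 <= s by rewrite sqrtr_ge0.
have sK : s ^+ 2 / (2 * K) = t / 2.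
  by rewrite sqr_sqrtr ?mulr_ge0 ?(ltW K0)//; field; exact: lt0r_neq0.
have H1 := rademacher_tail K0 s0 dK.
have dK' : \sum_i (- d i) ^+ 2 <= K by under eq_bigr do rewrite sqrrN.
have H2 := rademacher_tail K0 s0 dK'.
rewrite sK in H1 H2.
apply: (le_trans _ (le_trans (lerD H1 H2) _));
  last by rewrite -mulr2n mulr_natl.
rewrite -natrD ler_nat; apply: (leq_trans _ (leq_card_setU _ _).1).
apply/subset_leq_card/fintype.subsetP => e; rewrite !inE => tK.
under [X in _ || (_ <= X)]eq_bigr do rewrite mulrN.
rewrite sumrN -ler_normr -(ler_pXn2r (n := 2))// ?nnegrE//.
by rewrite real_normK ?num_real// sqr_sqrtr// mulr_ge0// ltW.
Qed.

End hoeffding.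

Section swap.
Context (R : realType) (n : nat).
Implicit Types (e : {ffun 'I_n -> bool}) (B : {set 'I_(n + n)}).

(** The exchange of the positions j and n + j, for every j selected by e. *)
Definition swap_halves e (i : 'I_(n + n)) : 'I_(n + n) :=
  match fintype.split i with
  | inl j => if e j then rshift n j else lshift n j
  | inr j => if e j then lshift n j else rshift n j
  end.

Lemma swap_halvesl e j :
  swap_halves e (lshift n j) = if e j then rshift n j else lshift n j.
Proof. by rewrite /swap_halves (unsplitK (inl _ j)). Qed.

Lemma swap_halvesr e j :
  swap_halves e (rshift n j) = if e j then lshift n j else rshift n j.
Proof. by rewrite /swap_halves (unsplitK (inr _ j)). Qed.

Lemma swap_halvesK e : involutive (swap_halves e).
Proof.
move=> i; case: (split_ordP i) => j ->.
  by rewrite swap_halvesl; case: ifPn => [|/negPf] ej;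
    rewrite (swap_halvesl, swap_halvesr) ej.
by rewrite swap_halvesr; case: ifPn => [|/negPf] ej;
  rewrite (swap_halvesl, swap_halvesr) ej.
Qed.

Definition fst_half B : R := \sum_(j < n) (lshift n j \in B)%:R.
Definition snd_half B : R := \sum_(j < n) (rshift n j \in B)%:R.

(** A set of positions in a double sample stands for the points that fall in
some S. The discrepancy is normalized by the total count because a relative
deviation bound is needed: the count has variance about n P S, not n. *)
Definition discrepant (t : R) B :=
  t * (fst_half B + snd_half B) < (fst_half B - snd_half B) ^+ 2.

(** An exchange fixes the sum of the counts of the halves and turns their
difference into the Rademacher sum with coefficients x j - y j in {-1, 0, 1}.
Since (x j - y j)^2 <= x j + y j, its variance is at most the sum of the
counts, so the normalization cancels. *)
Lemma card_swap_discrepant (t : R) B : 0 <= t ->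
  #|[set e | discrepant t (swap_halves e @^-1: B)]|%:R <=
  2 * (2 ^+ n * expR (- (t / 2))).
Proof.
move=> t0.
pose x j : R := (lshift n j \in B)%:R; pose y j : R := (rshift n j \in B)%:R.
pose B' e := (swap_halves e @^-1: B)%SET.
have sumE e : fst_half (B' e) + snd_half (B' e) = \sum_j (x j + y j).
  rewrite -big_split; apply: eq_bigr => j _ /=.
  by rewrite !inE swap_halvesl swap_halvesr; case: (e j) => //; rewrite addrC.
have subE e : fst_half (B' e) - snd_half (B' e) =
    \sum_j (-1) ^+ e j * (x j - y j).
  rewrite -sumrB; apply: eq_bigr => j _ /=.
  rewrite !inE swap_halvesl swap_halvesr; case: (e j).
    by rewrite expr1 mulN1r opprB.
  by rewrite expr0 mul1r.
set K := \sum_j (x j + y j) in sumE.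
have dK : \sum_j (x j - y j) ^+ 2 <= K.
  apply: ler_sum => j _; rewrite /x /y.
  by case: (_ \in B); case: (_ \in B);
    rewrite ?(subrr, expr0n, subr0, sub0r, sqrrN, expr1n)//=;
     lra.
have : 0 <= K by apply: le_trans dK; apply: sumr_ge0 => j _; rewrite sqr_ge0.
rewrite le_eqVlt => /predU1P[K0|K0].
  have d0 j : x j - y j = 0.
    apply/eqP; rewrite -sqrf_eq0 eq_le sqr_ge0 andbT.
    rewrite K0; apply: le_trans dK; rewrite (bigD1 j)//= lerDl.
    by apply: sumr_ge0 => i _; rewrite sqr_ge0.
  rewrite (_ : [set _ | _] =
    finset.set0) ?cards0 ?mulr_ge0 ?exprn_ge0 ?expR_ge0//.
  apply/setP => e; rewrite !inE /discrepant sumE -K0 subE mulr0.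
  by rewrite big1 ?expr0n ?ltxx// => j _; rewrite d0 mulr0.
apply: le_trans (rademacher_sqr_tail K0 t0 dK); rewrite ler_nat.
apply/subset_leq_card/fintype.subsetP => e; rewrite !inE /discrepant sumE subE.
exact: ltW.
Qed.

End swap.
Arguments fst_half {R n} B.
Arguments snd_half {R n} B.

(** * The Sauer-Shelah lemma *)

Section sauer.
Local Open Scope nat_scope.
Context (T : finType).
Implicit Types (F : {set {set T}}) (A B C : {set T}).

Definition shatters F B :=
  [forall C in powerset B, exists A in F, A :&: B == C].

Lemma shattersP F B :
  reflect (forall C, C \subset B -> exists2 A, A \in F & A :&: B = C)
          (shatters F B).
Proof.
apply: (iffP forall_inP) => [h C CB|h C].
  have /exists_inP[A AF /eqP] : [exists A in F, A :&: B == C].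
    by apply: h; rewrite inE.
  by exists A.
rewrite inE => /h[A AF ABC]; apply/exists_inP; exists A => //; exact/eqP.
Qed.

Lemma shattersS F F' B : F \subset F' -> shatters F B -> shatters F' B.
Proof.
move=> /fintype.subsetP FF' /shattersP h; apply/shattersP => C /h[A AF <-].
by exists A => //; exact: FF'.
Qed.

(** Pajor's form of the Sauer-Shelah lemma. Split F according to membership of
a point x that separates two of its members. Sets shattered by one of the two
parts avoid x, and a set B shattered by both yields two sets shattered by F,
namely B and x |: B. *)
Lemma card_le_shattered F : #|F| <= #|[set B | shatters F B]|.
Proof.
have [m] := ubnP #|F|; elim: m F => // m IHm F Fm.
have [F1|] := leqP #|F| 1.
  have [->|/set0Pn[A AF]] := eqVneq F finset.set0; first by rewrite cards0.
  apply: (leq_trans F1); rewrite card_gt0; apply/set0Pn.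
  exists finset.set0; rewrite inE; apply/shattersP => C.
  by rewrite finset.subset0 => /eqP ->; exists A => //; rewrite finset.setI0.
move=> /card_gt1P[A1 [A2 [A1F A2F A12]]].
have [x xA] : exists x, (x \in A1) != (x \in A2).
  apply/existsP; rewrite -negb_forall; apply: contra A12 => /forallP h.
  by apply/eqP/setP => x; apply/eqP/h.
pose G (b : bool) := [set A in F | (x \in A) == b].
have GF b : G b \subset F by apply/fintype.subsetP => A; rewrite inE => /andP[].
have Gm b : #|G b| < m.
  rewrite -ltnS; apply: leq_trans Fm; rewrite ltnS; apply: proper_card.
  rewrite properE GF/=; apply/subsetPn.
  case: (eqVneq (x \in A1) b) => [A1b|A1b]; [exists A2|exists A1] => //.
    by rewrite inE A2F/= -A1b eq_sym.
  by rewrite inE A1F.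
have FG : #|F| = #|G true| + #|G false|.
  rewrite -(cardsID [set A : {set T} | x \in A] F); congr (_ + _);
    apply: eq_card => A.
    by rewrite !inE eqb_id.
  by rewrite !inE eqbF_neg andbC.
pose H b := [set B | shatters (G b) B].
have xH b B : B \in H b -> x \notin B.
  rewrite inE => /shattersP h; apply/negP => xB.
  have [A] : exists2 A, A \in G b & A :&: B = (if b then finset.set0 else B).
    by apply: h; case: ifP => // _; rewrite finset.sub0set.
  rewrite inE => /andP[_ /eqP xb] /setP /(_ x); rewrite inE xb xB.
  by case: (b); rewrite ?finset.in_set0 ?xB.
have HF b : H b \subset [set B | shatters F B].
  by apply/fintype.subsetP => B; rewrite !inE; exact: shattersS.
rewrite FG (leq_trans (leq_add (IHm _ (Gm _)) (IHm _ (Gm _))))// -cardsUI.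
rewrite -/(H true) -/(H false).
have injx : {in H true :&: H false &, injective (fun B => x |: B)}.
  move=> B C /finset.setIP[/xH xB _] /finset.setIP[/xH xC _].
  by move=> /(congr1 (fun D => D :\ x)); rewrite !setU1K.
rewrite -(card_in_imset injx).
set I := [set _ | _ in _].
have UI0 : #|(H true :|: H false) :&: I| = 0.
  apply: eq_card0 => B; rewrite inE; apply/negP => /andP[].
  move=> /setUP BH /imsetP[C _ BC].
  have : x \in B by rewrite BC setU11.
  by apply/negP; case: BH; exact: xH.
rewrite -cardsUI UI0 addn0; apply: subset_leq_card;
  rewrite finset.subUset finset.subUset !HF/=.
apply/fintype.subsetP => B /imsetP[C /finset.setIP[CT CF] ->].
rewrite inE; apply/shattersP => D DxC.
have [A] : exists2 A, A \in G (x \in D) & A :&: C = D :\ x.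
  have : C \in H (x \in D) by case: (x \in D).
  rewrite inE => /shattersP; apply.
  by apply/fintype.subsetP => y;
    rewrite !inE => /andP[yx /(fintype.subsetP DxC)];
     rewrite !inE (negPf yx).
rewrite inE => /andP[AF /eqP xAD] ACD; exists A => //.
apply/setP => y; move/setP: ACD => /(_ y); rewrite !inE.
have [->|yx] := eqVneq y x; first by rewrite andbT xAD.
by [].
Qed.

(** The constant 5/4 bounds 1 + 1 / m for m >= 4, which is attained at v = 1;
the final union bound allows for 4/3. *)
Lemma card_small_subsets v : 3 < #|T| ->
  4 * #|[set B : {set T} | #|B| <= v]| <= 5 * #|T| ^ v.
Proof.
move=> T3.
have S k : #|[set B : {set T} | #|B| <= k.+1]| =
    #|[set B : {set T} | #|B| <= k]| + 'C(#|T|, k.+1).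
  rewrite -card_draws -cardsUI [X in _ = _ + X]eq_card0 ?addn0; last first.
    by move=> B; rewrite !inE; apply/negP => /andP[Bk /eqP Bk1];
      rewrite Bk1 ltnn in Bk.
  by apply: eq_card => B; rewrite !inE leq_eqVlt ltnS orbC.
elim: v => [|[|v] IHv].
- rewrite expn0 (_ : [set _ | _] = [set finset.set0]) ?cards1//.
  by apply/setP => B; rewrite !inE leqn0 cards_eq0.
- rewrite S bin1 expn1 (_ : [set _ | _] = [set finset.set0]) ?cards1//.
    by lia.
  by apply/setP => B; rewrite !inE leqn0 cards_eq0.
have : 2 * 'C(#|T|, v.+2) <= #|T| ^ v.+2.
  apply: (@leq_trans ('C(#|T|, v.+2) * (v.+2)`!)).
    by rewrite mulnC leq_mul// factS -[2]muln1 leq_mul// fact_gt0.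
  rewrite bin_ffact.
  elim: v.+2 => [|k IHk]; first by rewrite ffactn0 expn0.
  by rewrite ffactnSr expnSr leq_mul// leq_subr.
rewrite S [_ ^ v.+2]expnS; nia.
Qed.

Lemma sauer_shelah F v : 3 < #|T| -> (forall B, shatters F B -> #|B| <= v) ->
  4 * #|F| <= 5 * #|T| ^ v.
Proof.
move=> T3 Fv; apply: leq_trans (card_small_subsets v T3).
rewrite leq_mul2l/= (leq_trans (card_le_shattered F))//.
by apply/subset_leq_card/fintype.subsetP => B; rewrite !inE; exact: Fv.
Qed.

End sauer.

(** * Binomial variables and their means *)

Section binomial_cdf.
Context (R : realType) (p : R).
Hypothesis p01 : 0 <= p <= 1.

(** The probability that a binomial variable with parameters n and p is less
than k. Defined by conditioning on one trial, to match the recursion that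
defines the power of a measure, and with a strict inequality so that the value
0 at k = 0 starts the sequence. *)
Fixpoint binomial_below n k : R :=
  if k is k'.+1 then
    if n is n'.+1 then
      (1 - p) * binomial_below n' k'.+1 + p * binomial_below n' k'
    else 1
  else 0.

(** The expectation of f at a binomial variable, by the same recursion. *)
Fixpoint binomial_mean n (f : nat -> R) : R :=
  if n is n'.+1 then
    (1 - p) * binomial_mean n' f + p * binomial_mean n' (fun k => f k.+1)
  else f 0.

Local Notation a := binomial_below.

Let p0 : 0 <= p. Proof. by case/andP: p01. Qed.
Let q0 : 0 <= 1 - p. Proof. by case/andP: p01; lra. Qed.

Lemma binomial_below0 n : a n 0 = 0. Proof. by case: n. Qed.

Lemma binomial_belowS n k : a n.+1 k.+1 = (1 - p) * a n k.+1 + p * a n k.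
Proof. by []. Qed.

Lemma binomial_below_ge0 n k : 0 <= a n k.
Proof. by elim: n k => [|n IHn] [|k]//=; rewrite addr_ge0// mulr_ge0. Qed.

Lemma binomial_below_eq1 n k : (n < k)%N -> a n k = 1.
Proof.
elim: n k => [|n IHn] [|k]//= nk.
by rewrite !IHn//; [ring|exact: ltnW].
Qed.

Lemma binomial_below_ndecr n k : a n k <= a n k.+1.
Proof.
elim: n k => [|n IHn] [|k]; rewrite ?binomial_below0 ?binomial_below_ge0//.
by rewrite !binomial_belowS lerD// ler_wpM2l.
Qed.

Lemma binomial_below_gt0 n k : p < 1 -> 0 < a n k.+1.
Proof.
move=> p1; elim: n k => [|n IHn] k /=; first exact: ltr01.
by rewrite ltr_wpDr ?mulr_ge0 ?binomial_below_ge0// mulr_gt0// subr_gt0.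
Qed.

(** Convolution with a Bernoulli law preserves log-concavity. The inequality is
stated for all i <= j, not only for i = j.-1, because the mixed terms of the
induction step compare indices at distance two. *)
Lemma binomial_below_logconcave n i j : (i <= j)%N ->
  a n i * a n j.+1 <= a n i.+1 * a n j.
Proof.
elim: n i j => [|n IHn] [|i] [|j]// ij;
  rewrite ?binomial_below0 ?mul0r ?mulr0//.
all: rewrite ?mulr_ge0 ?binomial_below_ge0//.
have ij' : (i <= j)%N by [].
have cross : a n i * a n j.+2 <= a n i.+2 * a n j.
  have := ij'; rewrite leq_eqVlt => /predU1P[->|ltij]; first by rewrite mulrC.
  exact: le_trans (IHn i j.+1 (leqW ij')) (IHn i.+1 j ltij).
have H1 := IHn i.+1 j.+1 ij.
have H2 := IHn i j ij'.
rewrite !binomial_belowS -subr_ge0.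
set q := 1 - p; rewrite [leRHS](_ : _ =
  q ^+ 2 * (a n i.+2 * a n j.+1 - a n i.+1 * a n j.+2) +
  p ^+ 2 * (a n i.+1 * a n j - a n i * a n j.+1) +
  q * p * (a n i.+2 * a n j - a n i * a n j.+2)); last by ring.
by rewrite !addr_ge0// mulr_ge0 ?subr_ge0 ?sqr_ge0// mulr_ge0.
Qed.

Lemma binomial_mean_ler n (f g : nat -> R) :
  (forall k, f k <= g k) -> binomial_mean n f <= binomial_mean n g.
Proof.
by elim: n f g => [|n IHn] f g fg //=; rewrite lerD// ler_wpM2l ?IHn.
Qed.

Lemma binomial_mean_affine n (b c : R) :
  binomial_mean n (fun k => b + c * k%:R) = b + c * (n%:R * p).
Proof.
elim: n b => [|n IHn] b /=; first by ring.
under [X in _ + _ * binomial_mean n X]funext => k.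
  rewrite (_ : _ + _ = (b + c) + c * k%:R); last by rewrite -natr1; ring.
  over.
by rewrite !IHn -[n.+1%:R]natr1; ring.
Qed.

Lemma binomial_meanE n (f : nat -> R) :
  binomial_mean n f = \sum_(k < n.+1) (a n k.+1 - a n k) * f k.
Proof.
elim: n f => [|n IHn] f.
  by rewrite big_ord_recl big_ord0/= subr0 mul1r addr0.
rewrite [LHS]/= !IHn [RHS]big_ord_recl.
rewrite [X in _ = _ + X](_ : _ = \sum_(k < n.+1)
   ((1 - p) * ((a n k.+2 - a n k.+1) * f k.+1) +
     p * ((a n k.+1 - a n k) * f k.+1))); last first.
  by apply: eq_bigr => k _; rewrite lift0 !binomial_belowS; ring.
rewrite big_split/= -!mulr_sumr addrA; congr (_ + _).
rewrite [in RHS]big_ord_recr/= !(binomial_below_eq1 (leqnn _)).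
rewrite (@binomial_below_eq1 n n.+2)// subrr mul0r addr0.
by rewrite big_ord_recl/= !binomial_below0; ring.
Qed.

(** The tangent at c is written as an affine function of k, whose binomial mean
is explicit by [binomial_mean_affine]. *)
Lemma concave_seq_below_tangent (l : nat -> R) c k :
  (forall j, l j.+2 - l j.+1 <= l j.+1 - l j) ->
  l k <= (l c - (l c.+1 - l c) * c%:R) + (l c.+1 - l c) * k%:R.
Proof.
move=> lC.
have D i m : l (i + m).+1 - l (i + m)%N <= l i.+1 - l i.
  elim: m => [|m IHm]; first by rewrite addn0.
  by rewrite addnS; exact: le_trans IHm.
have [ck|kc] := leqP c k.
  rewrite -(subnKC ck); elim: (k - c)%N => [|m IHm];
    first by rewrite addn0; lra.
  by have := D c m; rewrite addnS -natr1; lra.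
rewrite -(subnKC (ltnW kc)); elim: (c - k)%N => [|m IHm];
  first by rewrite addn0; lra.
have := D (k + m)%N 1%N; rewrite !addn1 !addnS.
move: IHm; set u := (k + m)%N => IHm.
rewrite -[u.+1%:R]natr1 => H.
suff : (l u.+2 - l u.+1) * (u%:R - k%:R) <= (l u.+1 - l u) * (u%:R - k%:R)
  by lra.
by rewrite ler_wpM2r// subr_ge0 ler_nat leq_addr.
Qed.

(** E (ln F (X)) is an upper Riemann sum of the integral of ln over [0, 1]: each
jump b - c of F carries the value ln b, the largest one of ln on [c, b]. The
integral is -1, as g below is a primitive of ln. *)
Lemma binomial_mean_ln_cdf n :
  p < 1 -> -1 <= binomial_mean n (fun k => ln (a n k.+1)).
Proof.
move=> p1; rewrite binomial_meanE.
pose g (u : R) := u * ln u - u.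
have -> : -1 = \sum_(k < n.+1) (g (a n k.+1) - g (a n k)).
  rewrite -(big_mkord xpredT (fun k => g (a n k.+1) - g (a n k))).
  rewrite telescope_sumr// binomial_below0 binomial_below_eq1//.
  by rewrite /g ln1; ring.
apply: ler_sum => k _; set b := a n k.+1; set c := a n k.
have b0 : 0 < b by exact: binomial_below_gt0.
have : 0 <= c by exact: binomial_below_ge0.
rewrite le_eqVlt => /predU1P[<-|c0].
  by rewrite /g mul0r !subr0 gerBl ltW.
have : ln (b / c) <= b / c - 1.
  have := @le_ln1Dx _ (b / c - 1); rewrite addrCA subrr addr0; apply.
  by have : 0 < b / c; [rewrite divr_gt0|lra].
rewrite ln_div ?posrE// => h; have := ler_wpM2l (ltW c0) h.
rewrite !mulrBr mulr1 [c * (b * _)]mulrCA divff ?gt_eqF// mulr1.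
by rewrite /g; lra.
Qed.

(** Jensen's inequality for the concave sequence ln F, at an integer above the
mean. The case p = 1 is apart because F then vanishes below n. *)
Lemma binomial_cdf_mean n c : n%:R * p <= c%:R -> expR (-1) <= a n c.+1.
Proof.
move=> npc.
have [p1|p1] := ltP p 1; last first.
  rewrite binomial_below_eq1; first by rewrite expR_le1; lra.
  rewrite ltnS -(ler_nat R); move: npc; suff -> : p = 1 by rewrite mulr1.
  by apply/le_anti; rewrite p1 andbT; case/andP: p01.
have a0 k : 0 < a n k.+1 by exact: binomial_below_gt0.
rewrite -(@lnK _ (a n c.+1)) ?posrE// ler_expR.
apply: le_trans (binomial_mean_ln_cdf n p1) _.
pose l k := ln (a n k.+1).
have lC j : l j.+2 - l j.+1 <= l j.+1 - l j.
  rewrite lerBlDr addrAC lerBrDr /l -!lnM ?posrE// ler_ln ?posrE ?mulr_gt0//.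
  by rewrite mulrC; exact: binomial_below_logconcave.
apply: le_trans (binomial_mean_ler n (fun k =>
  concave_seq_below_tangent c k lC)) _.
rewrite binomial_mean_affine -/(l c).
have : 0 <= l c.+1 - l c.
  by rewrite subr_ge0 /l ler_ln ?posrE// binomial_below_ndecr.
set s := l c.+1 - l c => s0.
have := ler_wpM2l s0 npc; lra.
Qed.

Lemma expRN1_ge : 1 / 3 <= expR (-1 : R).
Proof.
(* exp (- 1/8) >= 1 - 1/8, and (7/8)^8 > 1/3. *)
have -> : -1 = 8%:R * (- (1 / 8)) :> R by lra.
rewrite expRM_natl.
apply: (@le_trans _ _ ((1 + - (1 / 8)) ^+ 8)); first by lra.
by apply: lerXn2r; rewrite ?nnegrE ?expR_ge0 ?expR_ge1Dx//; lra.
Qed.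

End binomial_cdf.

Local Open Scope classical_set_scope.
Local Open Scope ring_scope.

(** * Product measures on tuples *)

Section power_measure_theory.
Context d (X : measurableType d) (R : realType).

Definition box n (A : 'I_n -> set X) : set (n.-tuple X) :=
  [set x | forall i, A i (tnth x i)].

Lemma measurable_box n (A : 'I_n -> set X) :
  (forall i, measurable (A i)) -> measurable (box A).
Proof.
move=> mA.
rewrite (_ : box A =
    \bigcap_(i in [set: 'I_n]) ((fun x => tnth x i) @^-1` A i)).
  apply: fin_bigcap_measurable => // i _; rewrite -[X in measurable X]setTI.
  exact: measurable_tnth.
by apply/seteqP; split => [x Ax i _|x Ax i]; [exact: Ax|exact: (Ax i)].
Qed.

Lemma power_measure_boxE (P : probability X R) n (A : 'I_n -> set X) :
  (forall i, measurable (A i)) ->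
  power_measure P n (box A) = (\prod_(i < n) P (A i))%E.
Proof. exact: power_measure_box. Qed.

Lemma boxT n : box (fun=> setT) = [set: n.-tuple X].
Proof. by apply/seteqP; split. Qed.

(** Boxes are stable under intersection and generate the sigma-algebra of
tuples. *)
Lemma measure_box_unique n (m1 m2 : {measure set (n.-tuple X) -> \bar R}) :
  (m1 setT < +oo)%E ->
  (forall A, (forall i, measurable (A i)) -> m1 (box A) = m2 (box A)) ->
  forall B, measurable B -> m1 B = m2 B.
Proof.
move=> m1T m12 B mB.
pose G : set (set (n.-tuple X)) :=
  [set box A | A in [set A : 'I_n -> set X | forall i, measurable (A i)]].
apply: (measure_unique G (fun=> setT)) => //.
- apply/seteqP; split.
    apply: smallest_sub; first exact: smallest_sigma_algebra.
    rewrite -bigcup_seq => _ [i _] [A mA <-]; rewrite setTI.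
    apply: sub_sigma_algebra.
    exists (fun j => if j == i then A else setT).
      by move=> j; case: ifP.
    apply/seteqP; split=> x /=; first by move=> /(_ i); rewrite eqxx.
    by move=> Ax j; case: eqP => [->|].
  apply: smallest_sub; first exact: sigma_algebra_measurable.
  by move=> _ [A mA <-]; exact: measurable_box.
- move=> _ _ [A mA <-] [C mC <-]; exists (fun i => A i `&` C i).
    by move=> i; exact: measurableI.
  apply/seteqP; split=> x /=; first by move=> AC; split=> i; have [] := AC i.
  by move=> [Ax Cx] i; split; [exact: Ax|exact: Cx].
- by move=> _; exists (fun=> setT) => //; exact: boxT.
- by rewrite bigcup_const//; exists 0%N.
- by move=> _ [A mA <-]; exact: m12.
Qed.

Definition permute n (f : 'I_n -> 'I_n) (x : n.-tuple X) : n.-tuple X :=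
  [tuple tnth x (f i) | i < n].

Lemma measurable_permute n (f : 'I_n -> 'I_n) :
  measurable_fun [set: n.-tuple X] (permute f).
Proof.
apply/measurable_fun_tnthP => i.
rewrite (_ : _ \o _ = fun x => tnth x (f i)); first exact: measurable_tnth.
by apply/funext => x /=; rewrite tnth_mktuple.
Qed.

HB.instance Definition _ n f :=
  isMeasurableFun.Build _ _ _ _ (@permute n f) (@measurable_permute n f).

Lemma power_measure_permute (P : probability X R) n (f : 'I_n -> 'I_n) B :
  involutive f -> measurable B ->
  power_measure P n (permute f @^-1` B) = power_measure P n B.
Proof.
move=> fK mB.
transitivity (distribution (power_measure P n) (permute f) B) => //.
apply: measure_box_unique => // [|A mA].
  by rewrite (le_lt_trans (probability_le1 _ _)) ?ltry.
rewrite -[LHS]/(power_measure P n (permute f @^-1` box A)).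
rewrite (_ : _ @^-1` _ = box (A \o f)); last first.
  apply/seteqP; split=> x /= Ax i.
    by have := Ax (f i); rewrite /permute tnth_mktuple fK.
  by rewrite /permute tnth_mktuple; have := Ax (f i); rewrite /= fK.
rewrite -[RHS]/(power_measure P n (box A)).
rewrite !power_measure_boxE//; last by move=> i; exact: mA.
rewrite (reindex_inj (inv_inj fK))/=.
by apply: eq_bigr => i _; rewrite fK.
Qed.

Definition tcat m n (xy : m.-tuple X * n.-tuple X) : (m + n).-tuple X :=
  [tuple of xy.1 ++ xy.2].

Lemma measurable_tcat m n :
  measurable_fun [set: m.-tuple X * n.-tuple X] (@tcat m n).
Proof.
apply/measurable_fun_tnthP => i; case: (split_ordP i) => j ->.
  rewrite (_ : _ \o _ = (fun x => tnth x j) \o fst).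
    by apply: measurableT_comp => //; exact: measurable_tnth.
  by apply/funext => x /=; rewrite tnth_lshift.
rewrite (_ : _ \o _ = (fun x => tnth x j) \o snd).
  by apply: measurableT_comp => //; exact: measurable_tnth.
by apply/funext => x /=; rewrite tnth_rshift.
Qed.

HB.instance Definition _ m n :=
  isMeasurableFun.Build _ _ _ _ (@tcat m n) (@measurable_tcat m n).

Lemma power_measure_tcat (P : probability X R) m n B : measurable B ->
  (power_measure P m \x power_measure P n)%E (@tcat m n @^-1` B) =
  power_measure P (m + n) B.
Proof.
move=> mB.
transitivity (distribution
  (power_measure P m \x power_measure P n)%E (@tcat m n) B) => //.
apply: measure_box_unique => // [|A mA].
  by rewrite (le_lt_trans (probability_le1 _ _)) ?ltry.
rewrite -[LHS]/((power_measure P m \x power_measure P n)%E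
  (@tcat m n @^-1` box A)).
rewrite (_ : _ @^-1` _ = box (A \o @lshift m n) `*` box (A \o @rshift m n));
  last first.
  apply/seteqP; split=> -[x y] /=.
    move=> Axy; split => i /=.
      by have := Axy (lshift n i); rewrite /tcat tnth_lshift.
    by have := Axy (rshift m i); rewrite /tcat tnth_rshift.
  move=> [Ax Ay] i; case: (split_ordP i) => j ->.
    by rewrite /tcat tnth_lshift; exact: Ax.
  by rewrite /tcat tnth_rshift; exact: Ay.
rewrite product_measure1E; [|by apply: measurable_box => i; exact: mA..].
rewrite -[RHS]/(power_measure P (m + n) (box A)) power_measure_boxE//.
by rewrite big_split_ord/=; congr (_ * _)%E; apply: power_measure_boxE => i;
  exact: mA.
Qed.

Definition hits (S : set X) n (x : n.-tuple X) : R :=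
  \sum_(i < n) \1_S (tnth x i).

Lemma measurable_hits S n : measurable S -> measurable_fun setT (@hits S n).
Proof.
move=> mS; apply: measurable_sum => i.
by apply: measurableT_comp => //; exact: measurable_tnth.
Qed.

Lemma measurable_hits_lt S n (c : R) : measurable S ->
  measurable [set x : n.-tuple X | hits S x < c].
Proof.
move=> mS.
have := @measurable_hits S n mS measurableT _ (measurable_itv `]-oo, c[).
by rewrite setTI; congr measurable; apply/seteqP; split => x /=; rewrite in_itv.
Qed.

Lemma hits_tcons S n u (x : n.-tuple X) :
  hits S (tcons (u, x)) = \1_S u + hits S x.
Proof.
rewrite /hits big_ord_recl /tcons tnth0; congr (_ + _).
by apply: eq_bigr => i _; rewrite tnthS.
Qed.

Lemma power_measure_hits (P : probability X R) S n k : measurable S ->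
  power_measure P n [set x | hits S x < k%:R] =
  (binomial_below (fine (P S)) n k)%:E.
Proof.
move=> mS; have hits0 m (x : m.-tuple X) : 0 <= hits S x.
  by apply: sumr_ge0 => i _; rewrite indicE ler0n.
elim: n k => [|n IHn] [|k] /=.
- rewrite (_ : [set _ | _] = set0) ?measure0//.
  by apply/seteqP; split=> x //=; rewrite ltNge hits0.
- by rewrite diracE mem_set//= /hits big_ord0 ltr0n.
- rewrite (_ : [set _ | _] = set0) ?measure0//.
  by apply/seteqP; split=> x //=; rewrite ltNge hits0.
rewrite /distribution/= /pushforward.
have pS : fine (P (~` S)) = 1 - fine (P S).
  by rewrite probability_setC// -(fineK (fin_num_measure P S mS)) -EFinB.
have mL m k' : measurable [set x : m.-tuple X | hits S x < k'%:R].
  exact: measurable_hits_lt.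
rewrite (_ : _ @^-1` _ = (~` S `*` [set x | hits S x < k.+1%:R]) `|`
                         (S `*` [set x | hits S x < k%:R])); last first.
  apply/seteqP; split=> -[u x] /=; rewrite hits_tcons indicE.
    have [/set_mem Su|] := boolP (u \in S).
      by rewrite /= -[k.+1%:R]natr1 => ?; right; split=> //=; lra.
    by move=> /negP/= Su; rewrite add0r => ?; left; split=> //; move: Su;
      rewrite in_setE.
  case=> -[Su].
    by rewrite memNset//= add0r.
  by rewrite mem_set//= -[k.+1%:R]natr1 => ?; lra.
have mSC : measurable (~` S) by exact: measurableC.
rewrite measureU; [|by apply: measurableX => //; exact: mL..|].
  transitivity (P (~` S) * power_measure P n [set x | (hits S x < k.+1%:R)%R] +
                P S * power_measure P n [set x | (hits S x < k%:R)%R])%E.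
    by congr (_ + _)%E; apply: product_measure1E => //; exact: mL.
  rewrite !IHn -(fineK (fin_num_measure P _ (measurableC mS))) pS.
  by rewrite -(fineK (fin_num_measure P S mS)) -!EFinM -EFinD.
by apply/seteqP; split=> -[u x] /=; [case=> -[nSu _] [Su _]; exact: nSu|].
Qed.

End power_measure_theory.
Arguments hits {d X R} S {n} x.

(** * Symmetrization *)

Section ghost_sample.
Context d (X : measurableType d) (R : realType) (P : probability X R).
Variables (S : set X) (n : nat).
Hypothesis mS : measurable S.

(** The slack 2 accounts for the strict inequality and for rounding the mean to
the next integer. It is absorbed by the term tau of the deviation, as
n tau >= 4. *)
Lemma power_measure_hits_le_mean :
  ((1 / 3)%:E <=
   power_measure P n [set x | (hits S x < n%:R * fine (P S) + 2 :> R)%R])%E.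
Proof.
have p01 : 0 <= fine (P S) <= 1.
  by rewrite fine_ge0//= -lee_fin fineK ?fin_num_measure ?probability_le1.
have np0 : 0 <= n%:R * fine (P S) by rewrite mulr_ge0//; case/andP: p01.
have /andP[cnp npc] := truncn_itv np0.
set c := Num.truncn _ in cnp npc.
apply: (@le_trans _ _
  (power_measure P n [set x | (hits S x < c.+2%:R :> R)%R])%E).
  rewrite power_measure_hits// lee_fin (le_trans (expRN1_ge R))//.
  by apply: binomial_cdf_mean => //; exact: ltW.
apply: le_measure; rewrite ?inE; [exact: measurable_hits_lt..|].
by move=> x /= hc; apply: (lt_le_trans hc); rewrite -addn2 natrD lerD2r.
Qed.

End ghost_sample.

Lemma hitsC d (X : measurableType d) (R : realType) (S : set X) n
    (x : n.-tuple X) :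
  hits (~` S) x = n%:R - hits S x :> R.
Proof.
rewrite /hits -[n in n%:R]card_ord -sumr_const -sumrB.
by apply: eq_bigr => i _; rewrite !indicE in_setC; case: (_ \in S);
  rewrite ?subr0 ?subrr.
Qed.

Lemma power_measure_hits_ge_mean d (X : measurableType d) (R : realType)
    (P : probability X R) (S : set X) n : measurable S ->
  ((1 / 3)%:E <=
   power_measure P n [set x | (n%:R * fine (P S) - 2 < hits S x :> R)%R])%E.
Proof.
move=> mS; apply: le_trans (power_measure_hits_le_mean P n (measurableC mS)) _.
rewrite le_eqVlt; apply/orP; left; apply/eqP; congr (power_measure P n _).
have -> : fine (P (~` S)) = 1 - fine (P S).
  by rewrite probability_setC// -(fineK (fin_num_measure P S mS)) -EFinB.
by apply/seteqP; split => x /=; rewrite hitsC; lra.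
Qed.

Lemma measure_fin_bigcup0 d (T : measurableType d) (R : realType)
    (mu : {measure set T -> \bar R}) (I : finType) (F : I -> set T) :
  (forall i, measurable (F i)) -> (forall i, mu (F i) = 0%E) ->
  mu (\bigcup_(i in [set: I]) F i) = 0%E.
Proof.
move=> mF F0.
rewrite (_ : \bigcup_(i in _) F i = \big[setU/set0]_(i <- enum I) F i);
  last first.
  by rewrite -bigcup_seq; congr bigcup; apply/seteqP; split=> i //= _;
    rewrite mem_enum.
suff [] : measurable (\big[setU/set0]_(i <- enum I) F i) /\
   mu (\big[setU/set0]_(i <- enum I) F i) = 0%E by [].
elim/big_ind : _ => [|A B [mA A0] [mB B0]|i _].
- by rewrite measure0.
- by split; [exact: measurableU|exact: null_set_setU].
- by split.
Qed.

Section trace.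
Context (X : Type) (SS : set (set X)) (m : nat).
Implicit Types z : m.-tuple X.

(** Sets of positions rather than of points: a point may occur several times in
a sample. *)
Definition trace (S : set X) z : {set 'I_m} := finset (fun i => tnth z i \in S).

Definition traces z : {set {set 'I_m}} :=
  finset (fun B => `[< exists2 S, SS S & trace S z = B >]).

Lemma in_traces S z : SS S -> trace S z \in traces z.
Proof. by move=> SSS; rewrite finset.inE; apply/asboolP; exists S. Qed.

Lemma traceC S z : trace (~` S) z = finset.setC (trace S z).
Proof. by apply/setP => i; rewrite !finset.inE in_setC. Qed.

End trace.

Lemma trace_permute d (X : measurableType d) m (f : 'I_m -> 'I_m) S
    (z : m.-tuple X) :
  trace S (permute f z) = (f @^-1: trace S z)%SET.
Proof. by apply/setP => i; rewrite !finset.inE tnth_mktuple. Qed.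

Section symmetrization.
Context d (X : measurableType d) (R : realType) (P : probability X R).
Variables (SS : set (set X)) (n : nat) (t K : R).
Hypotheses (PSS : measurable_class P SS) (t0 : 0 <= t) (K0 : 0 <= K).
Hypothesis card_traces : forall z : (n + n).-tuple X, #|traces SS z|%:R <= K.

(** The complement of a trace of S is the trace of [~` S]: both are needed,
because the band is governed by the smaller of P_n S and P_n (~S). *)
Definition two_sided_discrepant (B : {set 'I_(n + n)}) :=
  discrepant t B || discrepant t (finset.setC B).

Lemma card_swap_two_sided (B : {set 'I_(n + n)}) :
  #|finset (fun e => two_sided_discrepant (swap_halves e @^-1: B)%SET)|%:R <=
  4 * (2 ^+ n * expR (- (t / 2))).
Proof.
have H1 := card_swap_discrepant B t0.
have H2 := card_swap_discrepant (finset.setC B) t0.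
have -> : 4 = 2 + 2 :> R by lra.
rewrite mulrDl; apply: (le_trans _ (lerD H1 H2)).
rewrite -natrD ler_nat; apply: (leq_trans _ (leq_card_setU _ _).1).
apply/subset_leq_card/fintype.subsetP => e.
by rewrite !finset.inE /two_sided_discrepant preimsetC.
Qed.

(** Averaging over all exchanges of the two halves of the double sample, which
preserve its law, reduces the bound to a count of exchanges for a fixed double
sample. The cover D consists of measurable versions of the sets on which a
discrepant pattern is cut out, together with a null set N that contains all
the errors made; outside the null set of double samples that some exchange
maps into N, membership in D means that a genuine trace is discrepant. *)
Lemma measurable_cover_discrepant : exists D : set ((n + n).-tuple X),
  [/\ measurable D,
      [set z | exists2 S, SS S & two_sided_discrepant (trace S z)] `<=` D &
      (power_measure P (n + n) D <= (K * (4 * expR (- (t / 2))))%:E)%E].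
Proof.
set M := power_measure P (n + n).
pose pat (b : {set 'I_(n + n)}) := [set z | exists2 S, SS S & trace S z = b].
have /choice[AN hAN] : forall b : {set 'I_(n + n)},
    exists AN : set ((n + n).-tuple X) * set ((n + n).-tuple X),
    [/\ measurable AN.1, measurable AN.2, M AN.2 = 0%E &
        AN.1 `+` pat b `<=` AN.2].
  move=> b; have [A mA [N [mN N0 AN]]] := PSS (fun i => i \in b).
  exists (A, N); split => //=; apply: subset_trans AN.
  suff -> : pat b =
      [set x | exists2 S, SS S & forall i, S (tnth x i) <-> i \in b] by [].
  apply/seteqP; split=> z [S SSS Sz]; exists S => //.
    by move=> i; rewrite -Sz finset.inE in_setE.
  by apply/setP => i; rewrite finset.inE; apply/idP/idP; rewrite in_setE => /Sz.
pose N := \bigcup_(b in [set: {set 'I_(n + n)}]) (AN b).2.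
pose D0 := \bigcup_(b in [set b | two_sided_discrepant b]) (AN b).1.
have mN : measurable N.
  by apply: fin_bigcup_measurable => // b _; have [] := hAN b.
have mD0 : measurable D0.
  by apply: fin_bigcup_measurable => // b _; have [] := hAN b.
have N0 : M N = 0%E.
  by apply: measure_fin_bigcup0 => b; have [] := hAN b.
exists (D0 `|` N); split; first exact: measurableU.
  move=> z [S SSS Sz]; have [Az|nAz] := pselect ((AN (trace S z)).1 z).
    by left; exists (trace S z).
  right; exists (trace S z) => //.
  by have [_ _ _] := hAN (trace S z); apply; right; split=> //; exists S.
set D := D0 `|` N; have mD : measurable D by exact: measurableU.
pose sw (e : {ffun 'I_n -> bool}) := permute (X := X) (swap_halves e).
have msw e (A : set _) : measurable A -> measurable (sw e @^-1` A).
  by move=> mA; rewrite -[_ @^-1` _]setTI; exact: measurable_permute.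
have Msw e (A : set _) : measurable A -> M (sw e @^-1` A) = M A.
  by apply: power_measure_permute; exact: swap_halvesK.
(* Both sides are integrated against M, and the integrands compared almost
   everywhere. *)
have two0 : 0 < 2 ^+ n :> R by rewrite exprn_gt0.
suff : ((2 ^+ n)%:E * M D <= (2 ^+ n)%:E * (K * (4 * expR (- (t / 2))))%:E)%E.
  by rewrite lee_pmul2l.
have -> : ((2 ^+ n)%:E * M D =
    \int[M]_z (\sum_(e : {ffun 'I_n -> bool}) (\1_(sw e @^-1` D) z)%:E))%E.
  rewrite ge0_integral_sum//.
  - rewrite (eq_bigr (fun=> M D)); last first.
      move=> e _; rewrite integral_indic; [|exact: measurableT|exact: msw].
      by rewrite setIT; exact: Msw.
    rewrite -(fineK (fin_num_measure M D mD)) sumEFin sumr_const.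
    by rewrite card_ffun card_bool card_ord -EFinM -[in RHS]mulr_natl natrX.
  - move=> e; apply/measurable_EFinP; apply: measurable_indic; exact: msw.
rewrite [leRHS](_ : _ =
   \int[M]_z (cst (K * (4 * (2 ^+ n * expR (- (t / 2)))))%:E z))%E; last first.
  rewrite integral_cst// [X in (_ = _ * X)%E](probability_setT M) mule1 -EFinM.
  by congr EFin; ring.
apply: ae_ge0_le_integral => //.
- by move=> z _; apply: sume_ge0.
- by apply: emeasurable_sum => e; apply/measurable_EFinP;
  apply: measurable_indic; exact: msw.
- by move=> z _; rewrite lee_fin !mulr_ge0 ?exprn_ge0 ?expR_ge0.
exists (\bigcup_(e in [set: {ffun 'I_n -> bool}]) (sw e @^-1` N)); split.
- by apply: fin_bigcup_measurable => // e _; exact: msw.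
- by apply: measure_fin_bigcup0 => e; [exact: msw|rewrite -N0; exact: Msw].
move=> z /= /not_implyP[_ zK]; apply: contrapT => zN; apply: zK.
rewrite sumEFin lee_fin.
set B := traces SS z.
apply: (@le_trans _ _ (\sum_(b in B) \sum_(e : {ffun 'I_n -> bool})
   (two_sided_discrepant (swap_halves e @^-1: b)%SET)%:R)).
  rewrite exchange_big/=; apply: ler_sum => e _; rewrite indicE.
  have [/set_mem|] := boolP (_ \in _); last by rewrite sumr_ge0.
  have nN : ~ N (sw e z) by move=> Nz; apply: zN; exists e.
  move=> /= [|//] [b bd Ab].
  have [S SSS Sb] : pat b (sw e z).
    apply: contrapT => npat; apply: nN; exists b => //.
    by have [_ _ _] := hAN b; apply; left.
  have tB : trace S z \in B by exact: in_traces.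
  rewrite (bigD1 (trace S z))//= -trace_permute Sb bd lerDl.
  by rewrite sumr_ge0.
apply: (@le_trans _ _ (\sum_(b in B) 4 * (2 ^+ n * expR (- (t / 2))))).
  apply: ler_sum => b _; apply: le_trans (card_swap_two_sided b).
  rewrite -sum1_card natr_sum [leRHS]big_mkcond/=.
  by apply: ler_sum => e _; rewrite finset.inE; case: ifP.
rewrite sumr_const -[X in X <= _]mulr_natl; apply: ler_wpM2r;
  last exact: card_traces.
by rewrite !mulr_ge0 ?exprn_ge0 ?expR_ge0.
Qed.

End symmetrization.

(** * Relative deviations, uniformly over the class *)

Section deviation.
Context d (X : measurableType d) (R : realType).

(** Both directions are measured on the scale sqrt (tau m) of the empirical
value m, since [hminus] and [hplus] are functions of the empirical value. *)
Definition deviates (tau p m : R) : Prop :=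
  m + Num.sqrt (tau * m) + tau < p \/ p + Num.sqrt (tau * m) + tau < m.

Lemma hits_ge0 (S : set X) n (x : n.-tuple X) : 0 <= hits S x :> R.
Proof. by apply: sumr_ge0 => i _; rewrite indicE ler0n. Qed.

Lemma empiricalE n (x : n.-tuple X) S : empirical R x S = n%:R^-1 * hits S x.
Proof. by []. Qed.

Lemma fst_half_trace n (x y : n.-tuple X) S :
  fst_half (trace S (tcat (x, y))) = hits S x :> R.
Proof. by apply: eq_bigr => j _; rewrite finset.inE /tcat tnth_lshift. Qed.

Lemma snd_half_trace n (x y : n.-tuple X) S :
  snd_half (trace S (tcat (x, y))) = hits S y :> R.
Proof. by apply: eq_bigr => j _; rewrite finset.inE /tcat tnth_rshift. Qed.

(** Here N m and b are the counts of the sample and of the ghost sample. With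
v = N sqrt (tau m), w = N tau / 2 and u = b - N m, the hypotheses give
u > v + w, whence u (u - w) > v^2; and u^2 > v^2 + w u is the conclusion. *)
Lemma above_mean_discrepancy (N tau m p b : R) : 0 < N -> 4 <= N * tau ->
  0 <= m ->
  m + Num.sqrt (tau * m) + tau < p -> N * p - 2 < b ->
  N * tau / 2 * (N * m + b) < (N * m - b) ^+ 2.
Proof.
move=> N0 Ntau m0 hp hb.
have tau0 : 0 <= tau by rewrite -(pmulr_rge0 _ N0) (le_trans _ Ntau).
pose v := N * Num.sqrt (tau * m); pose w := N * tau / 2; pose u := b - N * m.
have vE : v ^+ 2 = N * tau * (N * m).
  by rewrite /v exprMn sqr_sqrtr; [ring|exact: mulr_ge0].
have v0 : 0 <= v by rewrite mulr_ge0 ?sqrtr_ge0// ltW.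
have w0 : 0 <= w by rewrite /w; lra.
have uvw : v + w < u.
  by move: hp; rewrite -(ltr_pM2l N0) !mulrDr -/v /u /w; lra.
rewrite -/w (_ : w * (N * m + b) = v ^+ 2 + w * u); last first.
  by rewrite vE /u /w; field.
rewrite (_ : (N * m - b) ^+ 2 = u ^+ 2); last by rewrite /u; ring.
have : v * u <= (u - w) * u by rewrite ler_wpM2r; lra.
have : v * (v + w) <= v * u by rewrite ler_wpM2l// ltW.
have : 0 <= v * w by rewrite mulr_ge0.
have : 0 < (u - w - v) * u by rewrite mulr_gt0; lra.
by rewrite !expr2; lra.
Qed.

(** With u = N m - b the hypotheses give u > v, whence u^2 > v^2, and
v^2 = N tau (N m) is at least N tau (N m + b) / 2 as b <= N m. *)
Lemma below_mean_discrepancy (N tau m p b : R) : 0 < N -> 4 <= N * tau ->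
  0 <= m ->
  p + Num.sqrt (tau * m) + tau < m -> b < N * p + 2 ->
  N * tau / 2 * (N * m + b) < (N * m - b) ^+ 2.
Proof.
move=> N0 Ntau m0 hp hb.
have tau0 : 0 <= tau by rewrite -(pmulr_rge0 _ N0) (le_trans _ Ntau).
pose v := N * Num.sqrt (tau * m); pose w := N * tau / 2; pose u := N * m - b.
have vE : v ^+ 2 = N * tau * (N * m).
  by rewrite /v exprMn sqr_sqrtr; [ring|exact: mulr_ge0].
have v0 : 0 <= v by rewrite mulr_ge0 ?sqrtr_ge0// ltW.
have w0 : 0 <= w by rewrite /w; lra.
have uv : v < u.
  by move: hp; rewrite -(ltr_pM2l N0) !mulrDr -/v /u; lra.
rewrite -/w (_ : w * (N * m + b) = v ^+ 2 - w * u); last first.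
  by rewrite vE /u /w; field.
rewrite -/u.
have : 0 <= w * u by rewrite mulr_ge0//; lra.
have : v ^+ 2 < u ^+ 2 by rewrite ltr_pXn2r// nnegrE; lra.
lra.
Qed.

Lemma ghost_discrepant (P : probability X R) n tau S (x : n.-tuple X) :
  (0 < n)%N -> 4 <= n%:R * tau -> measurable S ->
  deviates tau (fine (P S)) (empirical R x S) ->
  exists2 H, measurable H & ((1 / 3)%:E <= power_measure P n H)%E /\
    forall y, H y -> discrepant (n%:R * tau / 2) (trace S (tcat (x, y))).
Proof.
move=> n0 ntau mS dev.
have nR0 : 0 < n%:R :> R by rewrite ltr0n.
have m0 : 0 <= empirical R x S
  by rewrite empiricalE mulr_ge0 ?invr_ge0 ?hits_ge0// ltW.
have hitsE : hits S x = n%:R * empirical R x S.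
  by rewrite empiricalE mulrA mulfV ?mul1r ?gt_eqF.
case: dev => dev.
- exists [set y | n%:R * fine (P S) - 2 < hits S y :> R].
    have := @measurable_hits _ X R S n mS measurableT _
      (measurable_itv `]n%:R * fine (P S) - 2, +oo[).
    by rewrite setTI; congr measurable; apply/seteqP; split => y /=;
      rewrite in_itv/= andbT.
  split; first exact: power_measure_hits_ge_mean.
  move=> y hy; rewrite /discrepant fst_half_trace snd_half_trace hitsE.
  exact: above_mean_discrepancy hy.
- exists [set y | hits S y < n%:R * fine (P S) + 2 :> R];
  first exact: measurable_hits_lt.
  split; first exact: power_measure_hits_le_mean.
  move=> y hy; rewrite /discrepant fst_half_trace snd_half_trace hitsE.
  exact: below_mean_discrepancy hy.
Qed.

Section uniform.
Variables (P : probability X R) (SS : set (set X)) (n : nat) (tau K : R).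
Hypotheses (SSmeas : forall S, SS S -> measurable S).
Hypotheses (PSS : measurable_class P SS).
Hypotheses (n0 : (0 < n)%N) (ntau : 4 <= n%:R * tau) (K0 : 0 <= K).
Hypothesis card_traces : forall z : (n + n).-tuple X, #|traces SS z|%:R <= K.

(** A bad sample x gives the section at x of the cover of discrepant double
samples a measure of at least 1/3, by [ghost_discrepant]. By Markov's
inequality such x have measure at most 3 times that of the cover. *)
Lemma uniform_relative_deviation : exists G : set (n.-tuple X),
  [/\ measurable G,
      (power_measure P n (~` G) <=
        (12 * (K * expR (- (n%:R * tau / 4))))%:E)%E &
      forall x S, G x -> SS S ->
        ~ deviates tau (fine (P S)) (empirical R x S) /\
        ~ deviates tau (fine (P (~` S))) (empirical R x (~` S))].
Proof.
have t0 : 0 <= n%:R * tau / 2 by rewrite divr_ge0// (le_trans _ ntau).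
have [D [mD badD MD]] := measurable_cover_discrepant PSS t0 K0 card_traces.
pose M := power_measure P n.
pose D2 := @tcat d X n n @^-1` D.
have mD2 : measurable D2 by rewrite -[D2]setTI; exact: measurable_tcat.
pose h x := M (xsection D2 x).
have mh : measurable_fun setT h by exact: measurable_fun_xsection.
have h0 x : (0 <= h x)%E by exact: measure_ge0.
pose B := [set x | ((1 / 3)%:E <= `|h x|)%E].
have mB : measurable B.
  rewrite -[B]setTI; apply: emeasurable_fun_c_infty => //.
  exact: measurableT_comp.
exists (~` B); split; first exact: measurableC.
  rewrite setCK.
  have three0 : (0 < 1 / 3 :> R) by lra.
  have := @le_integral_abse _ _ _ M setT measurableT h _ mh three0.
  rewrite setTI -/B.
  have -> : (\int[M]_x `|h x| = power_measure P (n + n) D)%E.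
    rewrite -power_measure_tcat//.
    by apply: eq_integral => x _; rewrite gee0_abs.
  move=> /le_trans/(_ MD).
  have MB : power_measure P n B = (fine (M B))%:E
    by rewrite fineK// fin_num_measure.
  rewrite [X in (_ * X)%E]MB MB -EFinM !lee_fin.
  rewrite [n%:R * tau / 2 / 2](_ : _ = n%:R * tau / 4); last by field.
  by set e := expR _; lra.
move=> x S nBx SSS.
have mS := SSmeas SSS.
have key S' : measurable S' -> S' = S \/ S' = ~` S ->
    deviates tau (fine (P S')) (empirical R x S') -> False.
  move=> mS' S'S dev; apply: nBx.
  have [H mH [H3 Hd]] := ghost_discrepant n0 ntau mS' dev.
  rewrite /B /= gee0_abs//; apply: (le_trans H3).
  apply: le_measure; rewrite ?inE//; first exact: measurable_xsection.
  move=> y /Hd dy; rewrite /xsection/= inE; apply: badD; exists S => //.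
  rewrite /two_sided_discrepant -traceC.
  by case: S'S dy => -> ->; rewrite ?orbT.
by split; apply: key => //; [left|exact: measurableC|right].
Qed.

End uniform.

End deviation.

(** * From the VC dimension to traces *)

Section vc.
Local Open Scope card_scope.

Lemma card_set_fin (T : finType) (B : {set T}) : [set` B] #= `I_#|B|.
Proof.
have -> : [set` B] = enum_val @` [set: 'I_#|B|].
  apply/seteqP; split=> [x /= xB|_ [i _ <-]]; last exact: enum_valP.
  by exists (enum_rank_in xB x) => //; rewrite enum_rankK_in.
apply: card_eq_trans (inj_card_eq (in2W enum_val_inj)) _.
have -> : `I_#|B| = @nat_of_ord #|B| @` setT.
  apply/seteqP; split=> [k /= kB|_ [i _ <-]]; last exact: ltn_ord.
  by exists (Ordinal kB).
by rewrite card_eq_sym; apply: inj_card_eq; exact: in2W val_inj.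
Qed.

Context (T : Type) (SS : set (set T)).

(** The points of a shattered set of positions are pairwise distinct, because
some S separates any two of them; hence the corresponding set of points has the
same cardinality and is itself shattered. *)
Lemma shattered_of_traces m (z : m.-tuple T) (B : {set 'I_m}) :
  shatters (traces SS z) B -> exists A, shattered_of_card SS A #|B|.
Proof.
move=> /shattersP shB.
have cut (C : {set 'I_m}) : C \subset B ->
    exists2 S, SS S & forall i, i \in B -> (tnth z i \in S) = (i \in C).
  move=> /shB[_ /[!finset.inE]/asboolP[S SSS <-] SC]; exists S => // i iB.
  by have /setP/(_ i) := SC; rewrite !finset.inE iB andbT.
have zinj : {in [set` B] &, injective (tnth z)}.
  move=> i j; rewrite !inE => iB jB zij.
  have iB1 : finset.set1 i \subset B by rewrite finset.sub1set.
  have [S _ Sc] := cut _ iB1.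
  have := Sc j jB; rewrite -zij Sc// !finset.in_set1 eqxx => /esym/eqP ->.
  by [].
exists (tnth z @` [set` B]); split.
  exact: card_eq_trans (inj_card_eq zinj) (card_set_fin B).
rewrite -card_powerset; apply: card_eq_trans (card_set_fin _).
pose g (C : {set 'I_m}) := tnth z @` [set` C].
have ginj : {in [set` powerset B] &, injective g}.
  move=> C D /set_mem /=; rewrite powersetE => CB /set_mem /=;
    rewrite powersetE => DB gCD.
  wlog suff : C D CB DB gCD / C \subset D.
    move=> h; apply/eqP; rewrite finset.eqEsubset; apply/andP; split;
      [exact: h|exact: (h D C)].
  apply/fintype.subsetP => i iC.
  have : g D (tnth z i) by rewrite -gCD; exists i.
  move=> [j /= jD zji]; suff <- : j = i by [].
  by apply: zinj => //; rewrite inE/=;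
    [apply: (fintype.subsetP DB)|apply: (fintype.subsetP CB)].
suff -> : [set tnth z @` [set` B] `&` S | S in SS] = g @` [set` powerset B].
  exact: inj_card_eq.
apply/seteqP; split.
  move=> _ [S SSS <-]; exists (B :&: trace S z)%SET;
    first by rewrite /= powersetE finset.subsetIl.
  apply/seteqP; split=> u /=.
    by move=> [i /=]; rewrite finset.in_setI finset.inE =>
      /andP[iB /set_mem Si] <-; split => //; exists i.
  by move=> [[i iB <-] Si]; exists i => //=;
    rewrite finset.in_setI finset.inE iB mem_set.
move=> _ [C /= + <-]; rewrite powersetE => CB; have [S SSS Sc] := cut C CB;
  exists S => //.
apply/seteqP; split=> u /=.
  move=> [[i iB <-] Si]; exists i => //=; rewrite -Sc//; exact: mem_set.
move=> [i iC <-]; have iB := fintype.subsetP CB _ iC.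
by split; [exists i|apply/set_mem; rewrite Sc].
Qed.

Context (R : realType).
Hypotheses (SSn0 : SS !=set0) (VCfin : (VC R SS < +oo)%E).

(** The supremum that defines the VC dimension is an extended real; its integer
part serves as the exponent in the Sauer-Shelah lemma. *)
Lemma VC_natbound : exists v : nat, v%:R <= fine (VC R SS) /\
  forall A m, shattered_of_card SS A m -> (m <= v)%N.
Proof.
have [A0 sh0] : exists A, shattered_of_card SS A 0.
  have [S SSS] := SSn0.
  have := @shattered_of_traces 0 [tuple] finset.set0; rewrite cards0; apply.
  apply/shattersP => C; rewrite finset.subset0 => /eqP ->.
  by exists (trace S [tuple]); [exact: in_traces|rewrite finset.setI0].
have VCge A m : shattered_of_card SS A m -> (m%:R%:E <= VC R SS)%E.
  by move=> sh; apply: ereal_sup_ubound; exists m => //; exists A.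
have VC0 : (0 <= VC R SS)%E := VCge _ _ sh0.
have VCf : VC R SS = (fine (VC R SS))%:E.
  by rewrite fineK// ge0_fin_numE.
exists (Num.truncn (fine (VC R SS))); split.
  by have /andP[] := @truncn_itv R (fine (VC R SS)) (fine_ge0 VC0).
move=> A m /VCge mV; rewrite truncn_ge_nat ?fine_ge0//.
by rewrite VCf lee_fin in mV.
Qed.

End vc.

(** * The confidence band of one sample *)

Section band.
Context d (X : measurableType d) (R : realType).
Variables (SS : set (set X)) (n : nat) (delta : R).
Hypotheses (delta01 : 0 < delta < 1).
Hypotheses (SSmeas : forall S, SS S -> measurable S) (SSn0 : SS !=set0).
Hypotheses (VCfin : (VC R SS < +oo)%E) (n0 : (0 < n)%N).
Hypothesis tau_le : tau SS n delta <= 1 / 2.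

Local Notation tau := (tau SS n delta).
Local Notation hp := (hplus SS n delta).
Local Notation hm := (hminus SS n delta).

(** The function V is the identity on [0, 1/2], where the deviation of S is
used, and t |-> 1 - t on [1/2, 1], where that of the complement is used. *)
Lemma band_of_deviation (p m : R) : 0 <= m <= 1 -> p <= 1 ->
  ~ deviates tau p m -> ~ deviates tau (1 - p) (1 - m) -> hm m <= p <= hp m.
Proof.
move=> /andP[m0 m1] p1 dev1 dev2.
have {dev1}[a1 b1] : p <= m + Num.sqrt (tau * m) + tau /\
                     m <= p + Num.sqrt (tau * m) + tau.
  by split; rewrite leNgt; apply/negP => ?; apply: dev1; [left|right].
have {dev2}[a2 b2] : 1 - p <= 1 - m + Num.sqrt (tau * (1 - m)) + tau /\
                     1 - m <= 1 - p + Num.sqrt (tau * (1 - m)) + tau.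
  by split; rewrite leNgt; apply/negP => ?; apply: dev2; [left|right].
rewrite /hminus /hplus le_min p1 andbT /Vfun (max_idPl _) ?subr_ge0//.
by case: (leP m (1 - m)) => _; apply/andP; split; lra.
Qed.

Lemma fineVC_ge0 : 0 <= fine (VC R SS).
Proof. by have [v [vV _]] := VC_natbound SSn0 VCfin; exact: le_trans vV. Qed.

Let nR0 : 0 < n%:R :> R. Proof. by rewrite ltr0n. Qed.

Lemma ntauE : n%:R * tau =
  4 * (fine (VC R SS) * ln (2 * n%:R) + ln (32 / delta)).
Proof. by rewrite /Defs.tau mulrC divfK// gt_eqF. Qed.

Lemma ln2n_ge0 : 0 <= ln (2 * n%:R : R).
Proof.
by rewrite ln_ge0//; have : 1 <= n%:R :> R; [rewrite ler1n|lra].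
Qed.

(** ln (32 / delta) >= ln 32 >= 1. *)
Lemma ntau_ge4 : 4 <= n%:R * tau.
Proof.
have d0 : 0 < delta by case/andP: delta01.
rewrite ntauE.
have : 1 <= ln (32 / delta).
  rewrite -ler_expR lnK ?posrE ?divr_gt0// ler_pdivlMr//.
  have e3 : expR 1 <= 3 :> R.
    by rewrite -[1]opprK expRN invf_ple ?posrE ?expR_gt0//;
      have := expRN1_ge R; lra.
  apply: (@le_trans _ _ (expR 1)); last lra.
  by rewrite ler_piMr ?expR_ge0//; case/andP: delta01 => _ /ltW.
by have := mulr_ge0 fineVC_ge0 ln2n_ge0; lra.
Qed.

Lemma n_ge8 : (8 <= n)%N.
Proof.
rewrite -(ler_nat R); have := ntau_ge4.
have := ler_wpM2l (ltW nR0) tau_le; lra.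
Qed.

Lemma card_traces_le (v : nat) (z : (n + n).-tuple X) :
  (forall A m, shattered_of_card SS A m -> (m <= v)%N) ->
  #|traces SS z|%:R <= 5 / 4 * (2 * n%:R) ^+ v :> R.
Proof.
move=> vP.
have sauer : (4 * #|traces SS z| <= 5 * (n + n) ^ v)%N.
  rewrite -[X in (_ * X ^ _)%N]card_ord; apply: sauer_shelah.
    by rewrite card_ord; have := n_ge8; lia.
  by move=> B /shattered_of_traces[A]; exact: vP.
rewrite -(ler_nat R) !natrM natrX natrD in sauer.
by rewrite (_ : 2 * n%:R = n%:R + n%:R); [lra|ring].
Qed.

(** The value of tau is chosen so that exp (- n tau / 4) cancels the growth of
the number of traces. *)
Lemma tail_le (v : nat) : v%:R <= fine (VC R SS) ->
  (2 * n%:R) ^+ v * expR (- (n%:R * tau / 4)) <= delta / 32 :> R.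
Proof.
move=> vV; have d0 : 0 < delta by case/andP: delta01.
have n20 : 0 < 2 * n%:R :> R by rewrite mulr_gt0.
have -> : n%:R * tau / 4 = fine (VC R SS) * ln (2 * n%:R) + ln (32 / delta).
  by rewrite ntauE; field.
rewrite opprD expRD -lnV ?posrE ?divr_gt0// invf_div lnK ?posrE ?divr_gt0//.
rewrite mulrA ler_piMl ?divr_ge0 ?(ltW d0)//.
rewrite -[X in X ^+ v]lnK ?posrE// -expRM_natl -expRD expR_le1.
by rewrite subr_le0 ler_wpM2r// ln2n_ge0.
Qed.

Section one_sample.
Variable P : probability X R.
Hypothesis PSS : measurable_class P SS.

Lemma sample_band : exists G : set (n.-tuple X),
  [/\ measurable G, (power_measure P n (~` G) <= (delta / 2)%:E)%E &
      forall x S, G x -> SS S ->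
        hm (empirical R x S) <= fine (P S) <= hp (empirical R x S) /\
        hm (empirical R x (~` S)) <= fine (P (~` S)) <=
          hp (empirical R x (~` S))].
Proof.
have [v [vV vP]] := VC_natbound SSn0 VCfin.
have K0 : 0 <= 5 / 4 * (2 * n%:R) ^+ v :> R.
  by rewrite mulr_ge0// exprn_ge0// mulr_ge0.
have [G [mG PG GS]] := uniform_relative_deviation SSmeas PSS n0 ntau_ge4 K0
  (fun z => card_traces_le z vP).
exists G; split => //.
  apply: (le_trans PG); rewrite lee_fin.
  have := tail_le vV; move: (expR _) => e; move: (_ ^+ v) => w.
  have : 0 < delta by case/andP: delta01.
  lra.
move=> x S Gx SSS; have [dev1 dev2] := GS x S Gx SSS.
have mS := SSmeas SSS.
have e01 S' : 0 <= empirical R x S' <= 1.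
  have hn : 0 <= (hits S' x : R) <= n%:R.
    by have := hits_ge0 R (~` S') x; rewrite hitsC hits_ge0 subr_ge0 => ->.
  by rewrite empiricalE mulrC divr_ge0 ?ler_pdivrMr ?mul1r//; case/andP: hn.
have p1 S' : measurable S' -> fine (P S') <= 1.
  by move=> mS'; rewrite -lee_fin fineK ?fin_num_measure ?probability_le1.
have eC : empirical R x (~` S) = 1 - empirical R x S.
  by rewrite !empiricalE hitsC mulrBr mulVf// gt_eqF.
have pC : fine (P (~` S)) = 1 - fine (P S).
  by rewrite probability_setC// -(fineK (fin_num_measure P S mS)) -EFinB.
split; apply: band_of_deviation => //; rewrite ?p1//.
- by rewrite -pC -eC.
- exact: measurableC.
- by rewrite pC eC !opprB !(addrC 1) !subrK.
Qed.

End one_sample.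
End band.

(** * Tests and the Neyman-Pearson lemma *)

Section test_functions.
Context d (X : measurableType d) (R : realType).

Definition test (phi : X -> R) :=
  measurable_fun [set: X] phi /\ forall x, 0 <= phi x <= 1.

Lemma test_indic (S : set X) : measurable S -> test \1_S.
Proof.
move=> mS; split; first exact: measurable_indic.
by move=> x; rewrite indicE; case: (_ \in _); rewrite ?lexx ?ler01.
Qed.

Lemma test_onem phi : test phi -> test (fun x => 1 - phi x).
Proof.
move=> [mphi phi01]; split; first exact: measurable_funB.
by move=> x; have := phi01 x; lra.
Qed.

Lemma test_cst (a : R) : 0 <= a <= 1 -> test (cst a).
Proof. by move=> a01; split => //; exact: measurable_cst. Qed.

Lemma integrable_test (P : probability X R) phi : test phi ->
  P.-integrable [set: X] (EFin \o phi).
Proof.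
move=> [mphi phi01].
apply: (@le_integrable _ _ _ P setT measurableT _ (cst 1%E)) => //.
- exact/measurable_EFinP.
- move=> x _ /=; rewrite lee_fin normr1 ger0_norm; by have /andP[] := phi01 x.
- exact: finite_measure_integrable_cst.
Qed.

Variables P Q : probability X R.

Lemma tradeoff_le_indic (S : set X) (a : R) : measurable S -> (P S <= a%:E)%E ->
  (tradeoff P Q a <= Q (~` S))%E.
Proof.
move=> mS PSa; apply: ereal_inf_lbound; exists \1_S.
  by have [? ?] := test_indic mS; split => //; rewrite expectation_indic.
rewrite -expectation_indic; last exact: measurableC.
by congr expectation; apply/funext => x; rewrite !indicE in_setC;
  case: (_ \in S);
  rewrite /= ?subrr ?subr0.
Qed.

Lemma tradeoff_le_onem (a : R) : 0 <= a <= 1 ->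
  (tradeoff P Q a <= (1 - a)%:E)%E.
Proof.
move=> a01; apply: ereal_inf_lbound; exists (cst a);
  last exact: (expectation_cst Q (1 - a)).
by have [? ?] := test_cst a01; split => //; rewrite expectation_cst.
Qed.

End test_functions.

Section neyman_pearson.
Context d (X : measurableType d) (R : realType) (P Q : probability X R).
Local Notation mu := (mixture P Q).

Lemma mixtureE A : mu A = ((2^-1)%:E * (P A + Q A))%E.
Proof. by rewrite -measure_addE. Qed.

Lemma mixture_eq0 A : mu A = 0%E -> P A = 0%E /\ Q A = 0%E.
Proof.
rewrite mixtureE => /eqP; rewrite mule_eq0 eqe invr_eq0 pnatr_eq0/=.
by rewrite padde_eq0// => /andP[/eqP -> /eqP ->].
Qed.

Lemma dominates_mixturel : P `<< mu.
Proof.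
by apply/null_content_dominatesP => A mA /mixture_eq0[].
Qed.

Lemma dominates_mixturer : Q `<< mu.
Proof.
by apply/null_content_dominatesP => A mA /mixture_eq0[].
Qed.

Section density.
Variables (nu : probability X R).
Hypothesis numu : nu `<< mu.

Lemma density_fin_num x : density P Q nu x \is a fin_num.
Proof. exact: Radon_Nikodym_fin_num. Qed.

Lemma integrable_density : mu.-integrable setT (density P Q nu).
Proof. exact: Radon_Nikodym_integrable. Qed.

Lemma measurable_density : measurable_fun setT (density P Q nu).
Proof. exact: measurable_int integrable_density. Qed.

Lemma integral_density A : measurable A ->
  nu A = (\int[mu]_(x in A) density P Q nu x)%E.
Proof.
move=> mA.
exact: (Radon_Nikodym_integral (nu := charge_of_finite_measure nu) numu mA).
Qed.

Lemma integrable_test_density phi : test phi ->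
  mu.-integrable setT (fun x => (phi x)%:E * density P Q nu x)%E.
Proof.
move=> [mphi phi01]; apply: le_integrable integrable_density => //.
  by apply: emeasurable_funM;
    [exact/measurable_EFinP|exact: measurable_density].
move=> x _; rewrite abseM -[leRHS]mul1e lee_wpmul2r// lee_fin ger0_norm;
  by have /andP[] := phi01 x.
Qed.

Lemma expectation_density phi : test phi ->
  ('E_nu[phi] = \int[mu]_x ((phi x)%:E * density P Q nu x))%E.
Proof.
move=> tphi; rewrite unlock.
by rewrite -(Radon_Nikodym_change_of_variables numu)//; exact: integrable_test.
Qed.

End density.

Lemma lagrangianE (l : R) f h : test f -> test h ->
  ('E_Q[f] + l%:E * 'E_P[h] =
   \int[mu]_x ((f x)%:E * density P Q Q x +
                l%:E * ((h x)%:E * density P Q P x)))%E.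
Proof.
move=> tf th.
rewrite (expectation_density dominates_mixturel th).
rewrite (expectation_density dominates_mixturer tf).
have ih := integrable_test_density dominates_mixturel th.
have jf := integrable_test_density dominates_mixturer tf.
have jh : mu.-integrable setT (fun x => l%:E * ((h x)%:E * density P Q P x))%E.
  exact: integrableZl.
by rewrite -integralZl// integralD.
Qed.

Lemma measurable_LR_region l : measurable (LR_region P Q l%:E).
Proof.
rewrite /LR_region -[X in measurable X]setTI; apply: emeasurable_fun_lt => //.
  by apply: measurable_funeM; exact: measurable_density dominates_mixturel.
exact: measurable_density dominates_mixturer.
Qed.

(** In terms of densities, the right-hand side minus the left-hand side is the
integral of (1 - phi) (q - l p) on the region q > l p, and of phi (l p - q) on
its complement; both integrands are nonnegative. *)
Lemma neyman_pearson (l : R) phi : test phi ->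
  (Q (~` LR_region P Q l%:E) + l%:E * P (LR_region P Q l%:E) <=
    'E_Q[(fun x => 1 - phi x)%R] + l%:E * 'E_P[phi])%E.
Proof.
set L := LR_region P Q l%:E => tphi;
  have mL : measurable L := measurable_LR_region l.
have mLC := measurableC mL.
rewrite -(expectation_indic Q mLC) -(expectation_indic P mL).
have tL := test_indic R mL; have tLC := test_indic R mLC.
rewrite !lagrangianE//; last exact: test_onem.
have I f h : test f -> test h -> mu.-integrable setT
   (fun x => (f x)%:E * density P Q Q x +
             l%:E * ((h x)%:E * density P Q P x))%E.
  move=> tf th; have jf := integrable_test_density dominates_mixturer tf.
  have jh := integrable_test_density dominates_mixturel th.
  by apply: integrableD => //; exact: integrableZl.
apply: le_integral => //; [exact: I|apply: I => //; exact: test_onem|].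
move=> x _.
have /= := density_fin_num dominates_mixturel x.
have /= := density_fin_num dominates_mixturer x.
have [_ /(_ x) phi01] := tphi.
rewrite !indicE in_setC.
have -> : (x \in L) = (l%:E * density P Q P x < density P Q Q x)%E.
  by apply/idP/idP; rewrite inE.
case: (density P Q Q x) => // q _; case: (density P Q P x) => // p _.
rewrite -!EFinM -!EFinD lte_fin lee_fin.
case: ltP => /= pq; rewrite ?mul0r ?mul1r ?mulr0 ?addr0 ?add0r.
  by have := ler_wpM2l (_ : 0 <= 1 - phi x) (ltW pq); lra.
by have := ler_wpM2l (_ : 0 <= phi x) pq; lra.
Qed.

End neyman_pearson.
Arguments dominates_mixturel {d X R} P Q.
Arguments dominates_mixturer {d X R} P Q.

(** * Convex functions below the trade-off curve *)

Lemma convex_function01P (R : realType) (g : R -> R) :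
  convex_function (`[0, 1] : set R^o) (g : R^o -> R^o) ->
  forall w x y : R, 0 <= w <= 1 -> 0 <= x <= 1 -> 0 <= y <= 1 ->
    g (w * x + (1 - w) * y) <= w * g x + (1 - w) * g y.
Proof.
move=> gC w x y /andP[w0 w1] x01 y01.
have := gC (Itv01 w0 w1) x y; rewrite !inE/= !in_itv/= => /(_ x01 y01).
by rewrite !convRE.
Qed.

(** The slope is the supremum of the slopes of the chords that end at a, which
are at most the slopes of the chords that start at a. *)
Lemma convex_supporting_line (R : realType) (g : R -> R) (a : R) :
  convex_function (`[0, 1] : set R^o) (g : R^o -> R^o) -> 0 < a < 1 ->
  exists s, forall t, 0 <= t <= 1 -> g a + s * (t - a) <= g t.
Proof.
move=> /convex_function01P gC /andP[a0 a1].
pose sl x := (g a - g x) / (a - x).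
pose E := [set sl x | x in [set x | 0 <= x < a]].
have chord x y : 0 <= x -> x < a -> a < y -> y <= 1 ->
    sl x <= (g y - g a) / (y - a).
  move=> x0 xa ay y1.
  have xy : 0 < y - x by lra.
  pose w := (y - a) / (y - x).
  have w01 : 0 <= w <= 1 by rewrite divr_ge0 ?ler_pdivrMr//; lra.
  have aE : w * x + (1 - w) * y = a by rewrite /w; field; lra.
  have x01 : 0 <= x <= 1 by lra.
  have y01 : 0 <= y <= 1 by lra.
  have := gC w x y w01 x01 y01; rewrite aE.
  have -> : 1 - w = (a - x) / (y - x) by rewrite /w; field; lra.
  rewrite /w !(mulrAC _ (y - x)^-1) -mulrDl ler_pdivlMr// => h.
  rewrite /sl ler_pdivrMr ?subr_gt0// mulrAC ler_pdivlMr ?subr_gt0//.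
  lra.
have E0 : E !=set0 by exists (sl 0); exists 0 => //=; rewrite lexx.
have Eub y : a < y -> y <= 1 -> ubound E ((g y - g a) / (y - a)).
  by move=> ay y1 _ [x /andP[x0 xa] <-]; exact: chord.
exists (sup E) => t /andP[t0 t1].
have [ta|ta|->] := ltgtP t a; last by rewrite subrr mulr0 addr0.
- have : sl t <= sup E.
    apply: ub_le_sup; last by exists t => //=; rewrite t0.
    by exists ((g 1 - g a) / (1 - a)); exact: Eub.
  by rewrite /sl ler_pdivrMr ?subr_gt0//; lra.
- have : sup E <= (g t - g a) / (t - a) by apply: ge_sup => //; exact: Eub.
  by rewrite ler_pdivlMr ?subr_gt0//; lra.
Qed.

Section lower_bound.
Context d (X : measurableType d) (R : realType) (P Q : probability X R).
Local Notation mu := (mixture P Q).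

Lemma measure_ae_indic (nu : probability X R) (S L : set X) :
  nu `<< mu -> measurable S -> measurable L ->
  {ae mu, forall x, \1_S x = \1_L x :> R} ->
  nu S = nu L /\ nu (~` S) = nu (~` L).
Proof.
move=> numu mS mL SL.
have SLnu : {ae nu, forall x, \1_S x = \1_L x :> R}.
  have [N [mN N0 subN]] := SL; exists N; split => //.
  by move/null_content_dominatesP : numu; apply.
suff nuE : nu S = nu L by split=> //; rewrite !probability_setC// nuE.
rewrite -[S]setIT -[L]setIT -!integral_indic//.
apply: ge0_ae_eq_integral => //; try exact/measurable_EFinP/measurable_indic.
by apply: filterS SLnu => x + _ => ->.
Qed.

Lemma measurable_LR_region_infty : measurable (LR_region P Q +oo%E).
Proof.
have := measurable_density (dominates_mixturel P Q) measurableT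
  (emeasurable_set1 0%E).
by rewrite setTI.
Qed.

Lemma LR_region_infty_null : P (LR_region P Q +oo%E) = 0%E.
Proof.
have mZ := measurable_LR_region_infty.
rewrite (integral_density (dominates_mixturel P Q) mZ).
by apply: integral0_eq => x /=.
Qed.

(** The density of P integrates to 0 over every measurable subset of B, so it
vanishes almost everywhere on B; but it does not vanish anywhere on B. *)
Lemma null_support (B : set X) : measurable B -> P B = 0%E ->
  B `<=` [set x | density P Q P x != 0%E] -> mu B = 0%E.
Proof.
move=> mB PB Bp.
have Pmu := dominates_mixturel P Q.
have : ae_eq mu B (density P Q P) (cst 0%E).
  apply: integral_ae_eq => //.
  - apply: (integrableS measurableT) => //; exact: (integrable_density Pmu).
  - move=> A AB mA; rewrite integral0 -integral_density//.
    by apply: (subset_measure0 mA mB AB).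
move=> [N [mN N0 BN]]; apply: (subset_measure0 mB mN _ N0).
move=> x Bx; apply: BN => /= h.
by have := Bp x Bx; rewrite /= h// eqxx.
Qed.

(** A test of level 0 vanishes outside a P-null set. Where the density of P is
not 0, this set is mu-null by [null_support], hence Q-null. *)
Lemma power_at_level0 (phi : X -> R) : test phi -> ('E_P[phi] <= 0)%E ->
  (Q (~` LR_region P Q +oo%E) <= 'E_Q[(fun x => 1 - phi x)%R])%E.
Proof.
move=> tphi Pphi0; have [mphi phi01] := tphi.
have phi0 x : (0 <= (phi x)%:E)%E by rewrite lee_fin; case/andP: (phi01 x).
have mZ := measurable_LR_region_infty.
have mphiE : measurable_fun setT (fun x => (phi x)%:E)
  by exact/measurable_EFinP.
pose A := [set x | phi x != 0].
have mA : measurable A.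
  rewrite (_ : A = ~` (phi @^-1` [set 0])); last first.
    by apply/seteqP; split=> x /= /eqP.
  by apply: measurableC; rewrite -[X in measurable X]setTI; exact: mphi.
have PA : P A = 0%E.
  have : (\int[P]_x `|(phi x)%:E| = 0)%E.
    under eq_integral do rewrite gee0_abs//.
    apply/eqP; rewrite eq_le integral_ge0// andbT.
    by move: Pphi0; rewrite unlock.
  move=> /(ae_eq_integral_abs _ measurableT mphiE)[N [mN N0 AN]].
  apply: (subset_measure0 mA mN _ N0) => x /eqP phix; apply: AN => /= h.
  by have [] := h I => /phix.
pose B := A `&` ~` LR_region P Q +oo%E.
have mB : measurable B by apply: measurableI => //; exact: measurableC.
have PB : P B = 0%E by apply: (subset_measure0 mB mA _ PA); exact: subIsetl.
have BZ : B `<=` [set x | density P Q P x != 0%E] by move=> x [_ /eqP].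
have [_ QB] := mixture_eq0 (null_support mB PB BZ).
have mZC := measurableC mZ.
rewrite -(expectation_indic Q mZC) unlock.
have t1 := test_onem tphi; have t2 := test_indic R mZC.
have mt1 : measurable_fun setT (fun x => (1 - phi x)%:E)
  by apply/measurable_EFinP; exact: (proj1 t1).
have mt2 : measurable_fun setT (fun x =>
  (\1_(~` LR_region P Q +oo%E) x)%:E : \bar R).
  by apply/measurable_EFinP; exact: (proj1 t2).
apply: ae_ge0_le_integral => //.
  by move=> x _; rewrite lee_fin; case/andP: (t1.2 x).
exists B; split => // x /= /not_implyP[_ h]; split.
  apply/negP => /eqP phix; apply: h; rewrite phix subr0 lee_fin.
  by case/andP: (t2.2 x).
apply: contrapT => /contrapT Zx; apply: h.
rewrite indicE memNset; last by apply.
by rewrite lee_fin; case/andP: (t1.2 x).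
Qed.

(** The Lagrange multiplier of the level constraint is minus the slope of a
supporting line of g at a; as the Lagrangian is minimized by a strict likelihood
ratio region whatever its level, it suffices to compare g with the class at such
regions. A positive slope would give a negative multiplier; then g at 1 is at
least g a. At a = 0 and a = 1 there may be no supporting line. *)
Theorem convex_minorant_le_tradeoff (SS : set (set X)) (g : R -> R) (a : R) :
  (forall S, SS S -> measurable S) -> SS setT -> attainable P Q SS ->
  convex_function (`[0, 1] : set R^o) (g : R^o -> R^o) ->
  (forall S, SS S -> ((g (fine (P S)))%:E <= Q (~` S))%E) ->
  0 <= a <= 1 -> ((g a)%:E <= tradeoff P Q a)%E.
Proof.
move=> SSm SST att gC gSS a01.
apply: le_ereal_inf_tmp => _ [phi [mphi phi01 Pphi] <-].
have tphi : test phi by [].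
have Q0 : (0 <= 'E_Q[(fun x => 1 - phi x)%R])%E.
  by rewrite expectation_ge0// => x; have := phi01 x; lra.
have g1 : g 1 <= 0.
  by have := gSS _ SST; rewrite probability_setT setCT measure0 lee_fin.
have [a1|a1] := eqVneq a 1.
  by rewrite a1 (le_trans _ Q0)// lee_fin.
have [a0|a0] := eqVneq a 0.
  rewrite a0 in Pphi *.
  have [S SSS Sae] := att +oo%E (leey _).
  have mS := SSm _ SSS.
  have mL := measurable_LR_region_infty.
  have [PS _] := measure_ae_indic (dominates_mixturel P Q) mS mL Sae.
  have [_ QS] := measure_ae_indic (dominates_mixturer P Q) mS mL Sae.
  have := gSS _ SSS; rewrite PS LR_region_infty_null QS => /le_trans; apply.
  exact: power_at_level0.
have {}a01 : 0 < a < 1.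
  by move: a01 a0 a1; rewrite !lt_neqAle => /andP[-> ->] /[!(eq_sym a)] -> ->.
have [s sP] := convex_supporting_line gC a01.
have [s0|s0] := ltP 0 s.
  apply: le_trans Q0; rewrite lee_fin; apply: le_trans g1.
  have := sP 1; rewrite ler01 lexx => /(_ isT); apply: le_trans.
  by rewrite lerDl mulr_ge0 ?(ltW s0)// subr_ge0; case/andP: a01 => _ /ltW.
pose l := - s; have l0 : 0 <= l by rewrite oppr_ge0.
have [S SSS Sae] := att l%:E l0.
have mS := SSm _ SSS.
have mL := measurable_LR_region P Q l.
have [PS _] := measure_ae_indic (dominates_mixturel P Q) mS mL Sae.
have [_ QS] := measure_ae_indic (dominates_mixturer P Q) mS mL Sae.
have := neyman_pearson P Q l tphi; rewrite -PS -QS.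
have := gSS _ SSS.
have p01 : 0 <= fine (P S) <= 1.
  by rewrite fine_ge0//= -lee_fin fineK ?fin_num_measure ?probability_le1.
have := sP _ p01.
rewrite -(fineK (fin_num_measure P S mS))
  -(fineK (fin_num_measure Q _ (measurableC mS))).
have tQ : 'E_Q[(fun x => 1 - phi x)%R]%E \is a fin_num.
  by rewrite unlock; apply: integrable_fin_num => //; apply: integrable_test;
    exact: test_onem.
have tP : 'E_P[phi]%E \is a fin_num.
  by rewrite unlock; apply: integrable_fin_num => //; exact: integrable_test.
rewrite -(fineK tQ) -(fineK tP) -!EFinM -!EFinD !lee_fin.
rewrite -(fineK tP) lee_fin in Pphi.
have := ler_wpM2l l0 Pphi; rewrite /l; lra.
Qed.

End lower_bound.

(** * The confidence bounds *)

Section final.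
Context d (X : measurableType d) (R : realType) (P Q : probability X R).
Variables (SS : set (set X)) (n : nat) (delta : R).
Hypothesis SSmeas : forall S, SS S -> measurable S.

Definition in_band (nu : probability X R) (x : n.-tuple X) (S : set X) :=
  hminus SS n delta (empirical R x S) <= fine (nu S) <=
    hplus SS n delta (empirical R x S).

Variables (x y : n.-tuple X).
Hypothesis bandP : forall S, SS S -> in_band P x S.
Hypothesis bandQ : forall S, SS S -> in_band Q y (~` S).

Lemma tradeoff_le_Uhat (a : R) : 0 <= a <= 1 ->
  (tradeoff P Q a <= Uhat SS delta x y a)%E.
Proof.
move=> a01; rewrite /Uhat le_min tradeoff_le_onem// andbT.
apply: le_ereal_inf_tmp => _ [S [SSS Sa] <-].
have mS := SSmeas SSS; have /andP[_ PS] := bandP SSS;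
  have /andP[_ QS] := bandQ SSS.
apply: le_trans (tradeoff_le_indic Q mS _) _.
  by rewrite -(fineK (fin_num_measure P S mS)) lee_fin (le_trans PS).
by rewrite -(fineK (fin_num_measure Q _ (measurableC mS))) lee_fin.
Qed.

Lemma gcm_Lhat_le_tradeoff (a : R) : SS setT -> attainable P Q SS ->
  0 <= a <= 1 ->
  (gcm (Lhat SS delta x y) a <= tradeoff P Q a)%E.
Proof.
move=> SST att a01; apply: ge_ereal_sup => _ [g [gC gL] <-].
apply: (convex_minorant_le_tradeoff SSmeas SST att gC) => // S SSS.
have mS := SSmeas SSS; have /andP[PS _] := bandP SSS;
  have /andP[QS _] := bandQ SSS.
have p01 : 0 <= fine (P S) <= 1.
  by rewrite fine_ge0//= -lee_fin fineK ?fin_num_measure ?probability_le1.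
apply: (le_trans (gL _ p01)); rewrite /Lhat ge_max measure_ge0 andbT.
apply: (@le_trans _ _ (hminus SS n delta (empirical R y (~` S)))%:E).
  by apply: ereal_inf_lbound; exists S.
by rewrite -(fineK (fin_num_measure Q _ (measurableC mS))) lee_fin.
Qed.

End final.

(** (1 - delta / 2)^2 >= 1 - delta. *)
Lemma with_probability_at_least_setX d1 d2 (T1 : measurableType d1)
    (T2 : measurableType d2) (R : realType) (P1 : probability T1 R)
    (P2 : probability T2 R) (G1 : set T1) (G2 : set T2) (delta : R)
    (E : set (T1 * T2)) : 0 < delta < 1 -> measurable G1 -> measurable G2 ->
  (P1 (~` G1) <= (delta / 2)%:E)%E -> (P2 (~` G2) <= (delta / 2)%:E)%E ->
  G1 `*` G2 `<=` E -> with_probability_at_least (P1 \x P2)%E (1 - delta) E.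
Proof.
move=> delta01 mG1 mG2 PG1 PG2 GE; exists (G1 `*` G2); split => //.
  exact: measurableX.
have -> : (P1 \x P2)%E (G1 `*` G2) = (fine (P1 G1) * fine (P2 G2))%:E.
  by rewrite product_measure1E// EFinM !fineK// fin_num_measure.
move: PG1 PG2; rewrite !probability_setC//.
rewrite -(fineK (fin_num_measure P1 _ mG1)) -(fineK (fin_num_measure P2 _ mG2)).
rewrite -!EFinB !lee_fin => h1 h2.
have : (1 - delta / 2) * (1 - delta / 2) <= fine (P1 G1) * fine (P2 G2).
  by apply: ler_pM; lra.
have := sqr_ge0 delta; rewrite expr2; lra.
Qed.

Theorem corollary4p1 (d : measure_display) (X : measurableType d) (R : realType)
    (delta : R) (delta01 : 0 < delta < 1)
    (SS : set (set X)) (SSmeas : forall S, SS S -> measurable S)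
    (SS0 : SS set0) (SST : SS setT) (VCfin : (VC R SS < +oo)%E)
    (n : nat) (n_gt0 : (0 < n)%N) (tau_le : tau SS n delta <= 1 / 2)
    (P Q : probability X R)
    (PSS : measurable_class P SS) (QSS : measurable_class Q SS) :
  with_probability_at_least (power_measure P n \x power_measure Q n)%E (1 - delta)
    [set xy | forall a : R, 0 <= a <= 1 ->
      (tradeoff P Q a <= Uhat SS delta xy.1 xy.2 a)%E]
  /\
  (attainable P Q SS ->
   with_probability_at_least (power_measure P n \x power_measure Q n)%E (1 - delta)
     [set xy | forall a : R, 0 <= a <= 1 ->
       (gcm (Lhat SS delta xy.1 xy.2) a <= tradeoff P Q a <=
          Uhat SS delta xy.1 xy.2 a)%E]).
Proof.
have SSn0 : SS !=set0 by exists set0.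
have [G [mG PG GP]] := sample_band delta01 SSmeas SSn0 VCfin n_gt0 tau_le PSS.
have [H [mH QH HQ]] := sample_band delta01 SSmeas SSn0 VCfin n_gt0 tau_le QSS.
have band x y : G x -> H y -> (forall S, SS S -> in_band SS delta P x S) /\
                              (forall S, SS S -> in_band SS delta Q y (~` S)).
  by move=> Gx Hy; split=> S SSS; [have [] := GP x S Gx SSS|have [] := HQ y S Hy SSS].
split=> [|att]; apply: (with_probability_at_least_setX delta01 mG mH PG QH).
  by move=> [x y] [/= Gx Hy] a a01; have [bP bQ] := band x y Gx Hy; exact: tradeoff_le_Uhat.
move=> [x y] [/= Gx Hy] a a01; have [bP bQ] := band x y Gx Hy.
by rewrite gcm_Lhat_le_tradeoff// tradeoff_le_Uhat.
Qed.
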